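(* Let $T$ be a tree with $n$ vertices and maximum degree $\Delta(T)\leq 3$. Then $E(T)=n$ if and only if $T$ is isomorphic to $S_2$ or to $Q$.
   Context: For a simple graph $G$ with adjacency eigenvalues $\lambda_1,\dots,\lambda_n$, the energy is $E(G)=\sum_{i=1}^n|\lambda_i|$. $S_2$ denotes the star on $2$ vertices, i.e. $K_2$. $Q$ denotes the tree on $6$ vertices obtained from $K_2$ by attaching two pendent edges to each of the two end vertices of $K_2$. *)

(* Defs.v *)
From HB Require Import structures.
From mathcomp Require Import all_boot all_order all_algebra.
From mathcomp Require Import complex reals.

Set Implicit Arguments.
Unset Strict Implicit.
Unset Printing Implicit Defensive.

Import Order.TTheory GRing.Theory Num.Theory.

Record sgraph := SGraph {
  vertex :> finType;
  adj : rel vertex;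
  adj_sym : symmetric adj;
  adj_irr : irreflexive adj }.

Definition graph_iso (G H : sgraph) : Prop :=
  exists2 f : G -> H, bijective f & forall x y, adj (f x) (f y) = adj x y.

Definition degree (G : sgraph) (x : G) : nat := #|[set y | adj x y]|.

Definition max_degree (G : sgraph) : nat := \max_(x : G) degree x.

Definition connected (G : sgraph) : Prop :=
  0 < #|G| /\ forall x y : G, connect (@adj G) x y.

(* In a simple graph, a duplicate-free closed walk [:: x; y] merely runs back
   and forth along an edge, so cycles have length at least 3. *)
Definition acyclic (G : sgraph) : Prop :=
  forall c : seq G, ucycle (@adj G) c -> size c < 3.

Definition is_tree (G : sgraph) : Prop := connected G /\ acyclic G.

Section Star.
Variable n : nat.

(* The centre is vertex 0. *)
Definition star_adj : rel 'I_n :=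
  fun x y => (x != y) && ((x == 0 :> nat) || (y == 0 :> nat)).

Lemma star_adj_sym : symmetric star_adj.
Proof. by move=> x y; rewrite /star_adj eq_sym orbC. Qed.

Lemma star_adj_irr : irreflexive star_adj.
Proof. by move=> x; rewrite /star_adj eqxx. Qed.

Definition star : sgraph := SGraph star_adj_sym star_adj_irr.
End Star.

Section AttachPendent.
Variables (G : sgraph) (k : nat).

(* k pendent edges attached to each vertex of G: inr (x, i) is the i-th new
   leaf at x. *)
Definition pendent_adj : rel (G + G * 'I_k)%type := fun u v =>
  match u, v with
  | inl x, inl y => adj x y
  | inl x, inr (y, _) => x == y
  | inr (x, _), inl y => x == y
  | inr _, inr _ => false
  end.

Lemma pendent_adj_sym : symmetric pendent_adj.
Proof. by move=> [x|[x i]] [y|[y j]] //=; rewrite ?(adj_sym x) // eq_sym. Qed.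

Lemma pendent_adj_irr : irreflexive pendent_adj.
Proof. by move=> [x|[x i]] //=; rewrite adj_irr. Qed.

Definition attach_pendent : sgraph := SGraph pendent_adj_sym pendent_adj_irr.
End AttachPendent.

Definition Q_tree : sgraph := attach_pendent (star 2) 2.

Local Open Scope ring_scope.

Section Energy.
Variable C : numClosedFieldType.

Definition adjacency_mx (G : sgraph) : 'M[C]_#|G| :=
  \matrix_(i, j) (adj (enum_val i) (enum_val j))%:R.

(* Roots of the characteristic polynomial, listed with multiplicity. *)
Definition eigenvalues n (A : 'M[C]_n) : seq C :=
  sval (closed_field_poly_normal (char_poly A)).

Lemma char_poly_eigenvalues n (A : 'M[C]_n) :
  char_poly A = \prod_(z <- eigenvalues A) ('X - z%:P).
Proof.
rewrite /eigenvalues; case: closed_field_poly_normal => r /= {1}->.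
by rewrite (monicP (char_poly_monic A)) scale1r.
Qed.

Definition energy (G : sgraph) : C :=
  \sum_(z <- eigenvalues (adjacency_mx G)) `|z|.
End Energy.

(* Main.v *)
From HB Require Import structures.
From Stdlib Require Import ZArith.
Require Import Defs.
From mathcomp Require Import all_boot all_order all_algebra.
From mathcomp Require Import complex reals ring zify ssrZ.

(* The energy is the nuclear norm of the adjacency matrix A, so tr (A X) <= E
   for every contraction X. Taking X block diagonal shows that deleting an edge
   cannot increase the sum of the energies of the pieces. Call a tree
   exceptional if it is S_1, S_3, S_4 or the 7-vertex tree in which two stars
   S_4 share a leaf; these have E < n. Root a tree at a leaf and cut off a
   minimal subtree that is not exceptional: minimality leaves only 11 shapes
   for it. If the remaining tree is not exceptional either, induction gives
   E >= n, strictly unless both pieces are K_2 or Q and hence the whole tree is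
   one of two explicit ones. If it is exceptional, the whole tree belongs to an
   explicit finite list. For the trees of these lists the strict inequality
   is certified by cutting them into pieces on which tr (A X) is evaluated for
   an explicit rational X. *)

Set Implicit Arguments.
Unset Strict Implicit.
Unset Printing Implicit Defensive.

Import Order.TTheory GRing.Theory Num.Theory.

(** * Rooted binary trees *)

(* Vertices are the occurrences of [Bin]; [Emp] marks a missing child, so that a
   subtree is removed by replacing it with [Emp]. *)
Inductive btree := Emp | Bin of btree & btree.

Definition btree_eq_dec (t u : btree) : {t = u} + {t <> u}.
Proof. decide equality. Defined.
HB.instance Definition _ := hasDecEq.Build btree (compareP btree_eq_dec).

Fixpoint nverts t := if t is Bin l r then (nverts l + nverts r).+1 else 0.

Fixpoint verts (t : btree) : finType :=
  if t is Bin l r then option (verts l + verts r) else void.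

Fixpoint isroot t : pred (verts t) :=
  match t with
  | Emp => fun _ => false
  | Bin l r => fun x : option (verts l + verts r) =>
      if x is None then true else false
  end.

Fixpoint tadj t : rel (verts t) :=
  match t with
  | Emp => fun _ _ => false
  | Bin l r => fun x y : option (verts l + verts r) =>
    match x, y with
    | None, Some (inl v) | Some (inl v), None => isroot v
    | None, Some (inr v) | Some (inr v), None => isroot v
    | Some (inl v), Some (inl w) => tadj v w
    | Some (inr v), Some (inr w) => tadj v w
    | _, _ => false
    end
  end.

Lemma tadj_sym t : symmetric (@tadj t).
Proof. by elim: t => [|l IHl r IHr] [] // [x|x] [[y|y]|] //=. Qed.

Lemma tadj_irr t : irreflexive (@tadj t).
Proof. by elim: t => [|l IHl r IHr] [] // [x|x] /=. Qed.

Definition tgraph t := SGraph (@tadj_sym t) (@tadj_irr t).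

Lemma card_verts t : #|verts t| = nverts t.
Proof.
elim: t => [|l IHl r IHr]; first exact: card_void.
by rewrite card_option card_sum IHl IHr.
Qed.

(** * Isomorphism of binary trees, free and rooted *)

Definition tiso t u := exists2 f : verts t -> verts u,
  bijective f & forall x y, tadj (f x) (f y) = tadj x y.

(** Isomorphism of rooted trees, as a boolean test that computes: equality up to exchanging the two
    children of any vertex. *)
Fixpoint sim t u :=
  match t, u with
  | Emp, Emp => true
  | Bin a b, Bin c d => (sim a c && sim b d) || (sim a d && sim b c)
  | _, _ => false
  end.

Lemma sim_refl t : sim t t.
Proof. by elim: t => //= l -> r ->. Qed.

Lemma sim_trans t u v : sim t u -> sim u v -> sim t v.
Proof.
elim: t u v => [|a IHa b IHb] [|c d] [|e f] //=.
case/orP=> /andP[h1 h2] /orP[] /andP[h3 h4]; apply/orP.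
- by left; rewrite (IHa _ _ h1 h3) (IHb _ _ h2 h4).
- by right; rewrite (IHa _ _ h1 h3) (IHb _ _ h2 h4).
- by right; rewrite (IHa _ _ h1 h4) (IHb _ _ h2 h3).
- by left; rewrite (IHa _ _ h1 h4) (IHb _ _ h2 h3).
Qed.

Lemma sim_size t u : sim t u -> nverts t = nverts u.
Proof.
elim: t u => [|a IHa b IHb] [|c d] //= /orP[]/andP[/IHa -> /IHb ->] //.
by rewrite addnC.
Qed.

(** The induction has to carry the root along, since a vertex is adjacent to its children through
    [isroot]. Injectivity is enough here: the sizes agree. *)
Lemma sim_rooted_iso t u : sim t u ->
  exists f : verts t -> verts u, [/\ injective f,
    forall x y, tadj (f x) (f y) = tadj x y
    & forall x, isroot (f x) = isroot x].
Proof.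
elim: t u => [|a IHa b IHb] [|c d] //=; first by exists id; split=> // x y.
case/orP=> /andP[/IHa [f [injf af rf]] /IHb [g [injg ag rg]]].
- exists (omap (fun s => match s with inl x => inl (f x) | inr y => inr (g y) end)).
  split=> [[[x|x]|] [[y|y]|]|[[x|x]|] [[y|y]|]|[[x|x]|]] //=.
  + by move=> [/injf ->].
  + by move=> [/injg ->].
- exists (omap (fun s => match s with inl x => inr (f x) | inr y => inl (g y) end)).
  split=> [[[x|x]|] [[y|y]|]|[[x|x]|] [[y|y]|]|[[x|x]|]] //=.
  + by move=> [/injf ->].
  + by move=> [/injg ->].
Qed.

Lemma sim_tiso t u : sim t u -> tiso t u.
Proof.
move=> s; have [f [injf af _]] := sim_rooted_iso s.
by exists f => //; apply: inj_card_bij => //; rewrite !card_verts (sim_size s).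
Qed.

(** * Cutting and grafting subtrees *)

(* [prune t t' u]: cutting the edge above some vertex of [t] leaves [t'] and the
   subtree [u] rooted at that vertex. *)
Inductive prune : btree -> btree -> btree -> Prop :=
| prune_here u : prune u Emp u
| prune_l l l' r u : prune l l' u -> prune (Bin l r) (Bin l' r) u
| prune_r l r r' u : prune r r' u -> prune (Bin l r) (Bin l r') u.

Lemma prune_size t t' u : prune t t' u -> nverts t = (nverts t' + nverts u)%N.
Proof. by elim=> //= *; lia. Qed.

Lemma prune_verts t t' u : prune t t' u ->
  exists f : verts t' + verts u -> verts t, [/\ bijective f,
    forall x y, tadj (f (inl x)) (f (inl y)) = tadj x y,
    forall x y, tadj (f (inr x)) (f (inr y)) = tadj x y
    & forall x, isroot (f (inl x)) = isroot x].
Proof.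
move=> s; suff [f [injf ? ? ?]] : exists f : verts t' + verts u -> verts t,
    [/\ injective f,
    forall x y, tadj (f (inl x)) (f (inl y)) = tadj x y,
    forall x y, tadj (f (inr x)) (f (inr y)) = tadj x y
    & forall x, isroot (f (inl x)) = isroot x].
  exists f; split=> //; apply: inj_card_bij => //.
  by rewrite card_sum !card_verts (prune_size s).
elim: s => {t t' u} [u|l l' r u _ [f [injf fl fr rf]]|l r r' u _ [f [injf fl fr rf]]].
- exists (fun s => match s with inl x => of_void _ x | inr y => y end).
  by split=> [[[]|x] [[]|y]|[]||[]] //= ->.
- exists (fun s => match s with
    | inl None => None
    | inl (Some (inl x)) => Some (inl (f (inl x)))
    | inl (Some (inr x)) => Some (inr x)
    | inr x => Some (inl (f (inr x))) end).
  split=> [[[[x|x]|]|x] [[[y|y]|]|y]|[[x|x]|] [[y|y]|]|x y|[[x|x]|]] //=;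
    case=> e; first [by case: (injf _ _ e) => -> | by case: (injf _ _ e) | by rewrite e].
- exists (fun s => match s with
    | inl None => None
    | inl (Some (inl x)) => Some (inl x)
    | inl (Some (inr x)) => Some (inr (f (inl x)))
    | inr x => Some (inr (f (inr x))) end).
  split=> [[[[x|x]|]|x] [[[y|y]|]|y]|[[x|x]|] [[y|y]|]|x y|[[x|x]|]] //=;
    case=> e; first [by case: (injf _ _ e) => -> | by case: (injf _ _ e) | by rewrite e].
Qed.

(** Both pieces of a cut may thus be replaced by representatives from finite lists, at the cost of
    changing the whole tree up to [sim]. *)
Lemma prune_sim t t' u t0' u0 : prune t t' u -> sim t' t0' -> sim u u0 ->
  exists2 t0, prune t0 t0' u0 & sim t t0.
Proof.
move=> s; elim: s t0' => {t t' u} [u|l l' r u _ IH|l r r' u _ IH] [|c d] //=.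
- by exists u0 => //; exact: prune_here.
- case/orP=> /andP[s1 s2] su; have [l0 h1 h2] := IH _ s1 su.
  + by exists (Bin l0 d); [exact: prune_l|rewrite /= h2 s2].
  + by exists (Bin c l0); [exact: prune_r|rewrite /= h2 s2 orbT].
- case/orP=> /andP[s1 s2] su; have [l0 h1 h2] := IH _ s2 su.
  + by exists (Bin c l0); [exact: prune_r|rewrite /= h2 s1].
  + by exists (Bin l0 d); [exact: prune_l|rewrite /= h2 s1 orbT].
Qed.

(** Runs through all ways of putting [u] in place of one [Emp] of [t]; the predicate passed down
    rebuilds the context of the current subtree. *)
Fixpoint all_graft (P : pred btree) t u :=
  if t is Bin l r then
    all_graft (fun l' => P (Bin l' r)) l u && all_graft (fun r' => P (Bin l r')) r u
  else P u.

Lemma all_graftP (P : pred btree) t t' u : prune t t' u -> all_graft P t' u -> P t.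
Proof.
move=> s; elim: s P => {t t' u} //= [l l' r u _ IH|l r r' u _ IH] P /andP[h1 h2].
  exact: (IH _ h1).
exact: (IH _ h2).
Qed.

(** Runs through all cuts above a vertex, again with the context stored in the predicate. *)
Fixpoint has_prune (P : btree -> btree -> bool) t :=
  if t is Bin l r then
    [|| P Emp t, has_prune (fun l' u => P (Bin l' r) u) l
      | has_prune (fun r' u => P (Bin l r') u) r]
  else false.

Lemma has_pruneP (P : btree -> btree -> bool) t : has_prune P t ->
  exists t' u, prune t t' u /\ P t' u.
Proof.
elim: t P => //= l IHl r IHr P /or3P[h|/IHl|/IHr].
- by exists Emp, (Bin l r); split=> //; exact: prune_here.
- by move=> [t' [u [s h]]]; exists (Bin t' r), u; split=> //; exact: prune_l.
- by move=> [t' [u [s h]]]; exists (Bin l t'), u; split=> //; exact: prune_r.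
Qed.

(** * Re-rooting at a leaf *)

(* [join a b] is the tree obtained by joining the roots of [a] and [b] by an
   edge; moving that edge through the tree re-roots it. *)
Definition join a b : rel (verts a + verts b) := fun x y =>
  match x, y with
  | inl v, inl w => tadj v w
  | inr v, inr w => tadj v w
  | inl v, inr w | inr w, inl v => isroot v && isroot w
  end.

Definition join_iso a b t := exists2 f : verts a + verts b -> verts t,
  bijective f & forall x y, tadj (f x) (f y) = join x y.

Lemma join_iso_emp t : join_iso t Emp t.
Proof.
exists (fun s => match s with inl x => x | inr x => of_void _ x end).
  by exists inl => // [[|[]]].
by move=> [x|[]] [y|[]].
Qed.

Lemma join_iso_sim a b a' b' t :
  sim a a' -> sim b b' -> join_iso a' b' t -> join_iso a b t.
Proof.
move=> sa sb [f bijf af].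
have [g [injg ag rg]] := sim_rooted_iso sa.
have [h [injh ah rh]] := sim_rooted_iso sb.
exists (fun s => f (match s with inl x => inl (g x) | inr y => inr (h y) end)).
  apply: bij_comp bijf _; apply: inj_card_bij.
    by move=> [x|x] [y|y] // [] => [/injg|/injh] ->.
  by rewrite !card_sum !card_verts (sim_size sa) (sim_size sb).
by move=> [x|x] [y|y]; rewrite af /= ?ag ?ah ?rg ?rh.
Qed.

(** Seen from [a], the vertex with children [a] and [c] that is joined to [b] is a vertex with
    children [c] and [b]. The tree stays the same; only the distinguished edge moves by one step. *)
Lemma join_iso_move a b c t : join_iso (Bin a c) b t -> join_iso a (Bin c b) t.
Proof.
move=> [f bijf af].
exists (fun s => f (match s with
  | inl x => inl (Some (inl x))
  | inr None => inl None
  | inr (Some (inl x)) => inl (Some (inr x))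
  | inr (Some (inr x)) => inr x end)).
  apply: bij_comp bijf _; apply: inj_card_bij.
    by move=> [x|[[x|x]|]] [y|[[y|y]|]] // [->].
  by rewrite !card_sum !card_verts /=; lia.
by move=> [x|[[x|x]|]] [y|[[y|y]|]]; rewrite af /= ?andbF ?andbT.
Qed.

(* The trees [s] such that rooting [join a b] at some leaf lying in [a] gives
   [Bin s Emp]. *)
Fixpoint leaf_rootings a b : seq btree :=
  if a is Bin c d then
    if (c == Emp) && (d == Emp) then [:: b] else
    leaf_rootings c (Bin d b) ++ leaf_rootings d (Bin c b)
  else [::].

Lemma leaf_rootingsP a b s t :
  s \in leaf_rootings a b -> join_iso a b t -> tiso (Bin s Emp) t.
Proof.
elim: a b => //= c IHc d IHd b; case: ifP => [/andP[/eqP-> /eqP->]|_].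
  rewrite inE => /eqP-> [f bijf af].
  exists (fun x : option (verts b + void) => f (match x with
    | None => inl None
    | Some (inl x) => inr x
    | Some (inr x) => of_void _ x end)).
    apply: bij_comp bijf _; apply: inj_card_bij.
      by move=> [[x|[]]|] [[y|[]]|] // [->].
    by rewrite card_sum !card_verts /=; lia.
  by move=> [[x|[]]|] [[y|[]]|]; rewrite af /= ?andbT.
rewrite mem_cat => /orP[/IHc h|/IHd h] j; apply: h; apply: join_iso_move => //.
(* Descending into the right child is descending into the left one after an exchange of the two. *)
apply: join_iso_sim j; last exact: sim_refl.
by rewrite /= !sim_refl orbT.
Qed.

(** Computable test that [t] is [Bin s Emp] as an unrooted tree. The first alternative accounts for
    the root of [t] being itself the leaf, which [leaf_rootings] does not list; comparing sizes
    first rejects most candidates cheaply. *)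
Definition rerooted t s := (nverts t == (nverts s).+1) &&
  (sim t (Bin s Emp) || has (sim s) (leaf_rootings t Emp)).

Lemma tiso_trans t u v : tiso t u -> tiso u v -> tiso t v.
Proof.
move=> [f bf af] [g bg ag]; exists (g \o f); first exact: bij_comp.
by move=> x y /=; rewrite ag af.
Qed.

Lemma tiso_sym t u : tiso t u -> tiso u t.
Proof.
move=> [f [g fK gK] af]; exists g; first by exists f.
by move=> x y; rewrite -af !gK.
Qed.

Lemma rerootedP t s : rerooted t s -> tiso (Bin s Emp) t.
Proof.
case/andP=> _ /orP[/sim_tiso/tiso_sym //|/hasP[s' s's ss']].
apply: tiso_trans (leaf_rootingsP s's (join_iso_emp t)).
by apply: sim_tiso; rewrite /= ss'.
Qed.

(** * Minimal non-exceptional subtrees *)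

Definition leaf := Bin Emp Emp.
Definition cherry := Bin leaf leaf.
Definition stalk := Bin cherry Emp.
Definition double_cherry := Bin cherry cherry.

(* The rooted trees in which the descendants of every vertex form an exceptional
   tree. *)
Definition stuck := [:: Emp; leaf; cherry; stalk; double_cherry].

(** The minimal subtrees that are not stuck: both branches are stuck, the whole is not. Up to [sim]
    these are 11 shapes. *)
Definition cuts := [seq u <- [seq Bin l r | l <- stuck, r <- stuck]
                      | ~~ has (sim u) stuck].

(** A cut found in a branch is a cut of the whole tree. If both branches are stuck, then the tree is
    stuck or is itself one of the [cuts]. *)
Lemma stuck_or_prune t :
  has (sim t) stuck \/
  exists t' u u0, [/\ prune t t' u, sim u u0 & u0 \in cuts].
Proof.
elim: t => [|l IHl r IHr]; first by left.
case: IHl => [/hasP[l0 l0B sl]|[l' [u [u0 [s su uc]]]]]; last first.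
  by right; exists (Bin l' r), u, u0; split=> //; exact: prune_l.
case: IHr => [/hasP[r0 r0B sr]|[r' [u [u0 [s su uc]]]]]; last first.
  by right; exists (Bin l r'), u, u0; split=> //; exact: prune_r.
have slr : sim (Bin l r) (Bin l0 r0) by rewrite /= sl sr.
have [/hasP[v vB sv]|nB] := boolP (has (sim (Bin l0 r0)) stuck).
  by left; apply/hasP; exists v => //; exact: sim_trans sv.
right; exists Emp, (Bin l r), (Bin l0 r0); split=> //; first exact: prune_here.
by rewrite mem_filter nB; apply: allpairs_f.
Qed.

(** * Trees of maximum degree at most 3 as leaf-rooted binary trees *)

Lemma ex_root t : t != Emp -> exists x : verts t, isroot x.
Proof. by case: t => // l r _; exists None. Qed.

Fixpoint nchild t : verts t -> nat :=
  match t with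
  | Emp => fun _ => 0
  | Bin l r => fun x : option (verts l + verts r) =>
    match x with
    | None => (l != Emp) + (r != Emp)
    | Some (inl v) => nchild v
    | Some (inr v) => nchild v
    end
  end.

(** A lower bound on the degree; against maximum degree 3 it will show that a vertex with a further
    neighbour outside the tree has room for a new leaf. *)
Lemma neighbours t (x : verts t) : exists s : seq (verts t),
  [/\ uniq s, all (tadj x) s & size s = nchild x + ~~ isroot x].
Proof.
elim: t x => [|l IHl r IHr] [] // => [[x|x]|].
- have [s [us As ss]] := IHl x.
  have ui : uniq [seq Some (inl y) : verts (Bin l r) | y <- s].
    by rewrite map_inj_uniq // => y z [].
  have [rx|nrx] := boolP (isroot x).
    exists (None :: [seq Some (inl y) | y <- s]); split.
    + by rewrite /= ui andbT; apply/mapP => -[].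
    + by rewrite /= rx all_map; apply: sub_all As.
    + by rewrite /= size_map ss rx; lia.
  exists [seq Some (inl y) | y <- s]; split=> //.
    by rewrite all_map; apply: sub_all As.
  by rewrite size_map ss nrx.
- have [s [us As ss]] := IHr x.
  have ui : uniq [seq Some (inr y) : verts (Bin l r) | y <- s].
    by rewrite map_inj_uniq // => y z [].
  have [rx|nrx] := boolP (isroot x).
    exists (None :: [seq Some (inr y) | y <- s]); split.
    + by rewrite /= ui andbT; apply/mapP => -[].
    + by rewrite /= rx all_map; apply: sub_all As.
    + by rewrite /= size_map ss rx; lia.
  exists [seq Some (inr y) | y <- s]; split=> //.
    by rewrite all_map; apply: sub_all As.
  by rewrite size_map ss nrx.
- have [->|ln] := eqVneq l Emp; have [->|rn] := eqVneq r Emp.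
  + by exists [::].
  + have [y ry] := ex_root rn.
    by exists [:: Some (inr y)]; rewrite /= ry rn.
  + have [x rx] := ex_root ln.
    by exists [:: Some (inl x)]; rewrite /= rx ln.
  + have [[x rx] [y ry]] := (ex_root ln, ex_root rn).
    by exists [:: Some (inl x); Some (inr y)]; rewrite /= rx ry ln rn.
Qed.

(** [u] is [t] with a new leaf [h None] attached to [x]. *)
Definition grows t (x : verts t) u (h : option (verts t) -> verts u) :=
  [/\ bijective h, forall y z, tadj (h (Some y)) (h (Some z)) = tadj y z
    & forall y, tadj (h None) (h (Some y)) = (y == x)].

Lemma grow_below t (x : verts t) : nchild x <= 1 ->
  exists u (h : option (verts t) -> verts u),
  [/\ grows x h, forall y, isroot (h (Some y)) = isroot y & ~~ isroot (h None)].
Proof.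
elim: t x => [|l IHl r IHr] [] // => [[x|x]|].
- move=> /IHl[u [h [[bh ha hx] rh nrh]]].
  exists (Bin u r), (fun y => match y with
    | None => Some (inl (h None)) | Some None => None
    | Some (Some (inl y)) => Some (inl (h (Some y)))
    | Some (Some (inr y)) => Some (inr y) end).
  split; last by []; last by move=> [[y|y]|].
  split=> [|[[y|y]|] [[z|z]|]|[[y|y]|]] //=; last by rewrite (negbTE nrh).
  apply: inj_card_bij.
    move=> [[[y|y]|]|] [[[z|z]|]|] // [];
      first [by move=> -> | by move=> /(bij_inj bh) // [->]].
  by rewrite !card_option !card_sum -(bij_eq_card bh) card_option; lia.
- move=> /IHr[u [h [[bh ha hx] rh nrh]]].
  exists (Bin l u), (fun y => match y with
    | None => Some (inr (h None)) | Some None => None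
    | Some (Some (inr y)) => Some (inr (h (Some y)))
    | Some (Some (inl y)) => Some (inl y) end).
  split; last by []; last by move=> [[y|y]|].
  split=> [|[[y|y]|] [[z|z]|]|[[y|y]|]] //=; last by rewrite (negbTE nrh).
  apply: inj_card_bij.
    move=> [[[y|y]|]|] [[[z|z]|]|] // [];
      first [by move=> -> | by move=> /(bij_inj bh) // [->]].
  by rewrite !card_option !card_sum -(bij_eq_card bh) card_option; lia.
- move=> /= le1; have [->|ln] := eqVneq l Emp.
    exists (Bin (Bin Emp Emp) r), (fun y => match y with
    | None => Some (inl None) | Some None => None
    | Some (Some (inl y)) => of_void _ y
    | Some (Some (inr y)) => Some (inr y) end).
    split; last by []; last by move=> [[[]|y]|].
    split=> [|[[[]|y]|] [[[]|z]|]|[[[]|y]|]] //=.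
    apply: inj_card_bij; last by rewrite !(card_option, card_sum, card_void); lia.
    by move=> [[[[]|y]|]|] [[[[]|z]|]|] // [->].
  have -> : r = Emp by apply/eqP; move: le1; rewrite ln; case: (r == Emp).
  exists (Bin l (Bin Emp Emp)), (fun y => match y with
    | None => Some (inr None) | Some None => None
    | Some (Some (inr y)) => of_void _ y
    | Some (Some (inl y)) => Some (inl y) end).
  split; last by []; last by move=> [[y|[]]|].
  split=> [|[[y|[]]|] [[z|[]]|]|[[y|[]]|]] //=.
  apply: inj_card_bij; last by rewrite !(card_option, card_sum, card_void); lia.
  by move=> [[[y|[]]|]|] [[[z|[]]|]|] // [->].
Qed.

(* A neighbour of the root becomes the new root, so the root remains a leaf. *)
Lemma grow_leaf_rooted s (x : verts (Bin s Emp)) : nchild x + ~~ isroot x <= 2 ->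
  exists u (h : option (verts (Bin s Emp)) -> verts (Bin u Emp)), grows x h.
Proof.
case: x => [[x|[]]|] /= => [|_].
  rewrite addn1 ltnS => /grow_below[u [h [[bh ha hx] rh nrh]]].
  exists u, (fun y => match y with
    | None => Some (inl (h None)) | Some None => None
    | Some (Some (inl y)) => Some (inl (h (Some y)))
    | Some (Some (inr y)) => of_void _ y end).
  split=> [|[[y|[]]|] [[z|[]]|]|[[y|[]]|]] //=; last by rewrite (negbTE nrh).
  apply: inj_card_bij.
    by move=> [[[y|[]]|]|] [[[z|[]]|]|] // [] /(bij_inj bh) // [->].
  by rewrite !card_option !card_sum -(bij_eq_card bh) card_option; lia.
exists (Bin s Emp), (fun y => if y is Some y then Some (inl y) else None).
split=> [|y z|y] //=.
apply: inj_card_bij; last by rewrite !(card_option, card_sum, card_void); lia.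
by move=> [y|] [z|] // [->].
Qed.

Lemma connect_homo (T U : finType) (e : rel T) (e' : rel U) (f : T -> U) x y :
  {homo f : v w / e v w >-> e' v w} -> connect e x y -> connect e' (f x) (f y).
Proof.
move=> fe /connectP[p ep ->]; apply/connectP; exists (map f p).
  exact: homo_path ep.
by rewrite last_map.
Qed.

Lemma tadj_connect_root t (r x : verts t) : isroot r -> connect (@tadj t) r x.
Proof.
elim: t r x => [[]|l IHl r IHr] //.
move=> [s|] // [[x|x]|] // _.
  have /ex_root[y ry] : l != Emp by case: l x {IHl} => [[]|].
  apply: (@connect_trans _ _ (Some (inl y))); first by apply: connect1.
  exact: (@connect_homo _ _ _ (@tadj (Bin l r)) (fun v => Some (inl v)) _ _ _ (IHl y x ry)).
have /ex_root[y ry] : r != Emp by case: r x {IHr} => [[]|].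
apply: (@connect_trans _ _ (Some (inr y))); first by apply: connect1.
exact: (@connect_homo _ _ _ (@tadj (Bin l r)) (fun v => Some (inr v)) _ _ _ (IHr y x ry)).
Qed.

Lemma tadj_connected s (x y : verts (Bin s Emp)) : connect (@tadj (Bin s Emp)) x y.
Proof.
apply: (@connect_trans _ _ None); last exact: tadj_connect_root.
by rewrite [connect _ _ _](sym_connect_sym (@tadj_sym (Bin s Emp))); exact: tadj_connect_root.
Qed.

Lemma connect_exit (T : finType) (e : rel T) (P : pred T) x y :
  connect e x y -> P x -> ~~ P y -> exists v w, [/\ e v w, P v & ~~ P w].
Proof.
move=> /connectP[p]; elim: p x => [|z p IH] x /=.
  by move=> _ -> Px; rewrite Px.
move=> /andP[exz ep] yE Px nPy; have [Pz|nPz] := boolP (P z).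
  exact: IH ep yE Pz nPy.
by exists x, z.
Qed.

(** If [y] had two neighbours in the embedded tree, the path joining them there would close up
    through [y] to a cycle. *)
Lemma acyclic_attach (G : sgraph) s (f : verts (Bin s Emp) -> G) x x' y :
  acyclic G -> injective f -> (forall v w, adj (f v) (f w) = tadj v w) ->
  y \notin codom f -> adj (f x) y -> adj (f x') y -> x' = x.
Proof.
move=> acG injf fa yf ax ax'; apply/eqP/negPn/negP => neq.
have /connectP[p0 ep0 lp0] := tadj_connected x x'.
case/shortenP: ep0 lp0 => p ep up _ lp.
have : ucycle (@adj G) (y :: f x :: map f p).
  have um : uniq (f x :: map f p) by rewrite -map_cons map_inj_uniq.
  have yp : y \notin f x :: map f p.
    by rewrite -map_cons; apply: contra yf => /mapP[v _ ->]; exact: codom_f.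
  rewrite /ucycle cons_uniq yp um andbT /= adj_sym ax /= rcons_path last_map -lp.
  by rewrite ax' !andbT; apply: homo_path ep => v w; rewrite fa.
(* The closed walk has length [size p + 2], so acyclicity forces [p] to be empty. *)
by move/acG; case: p {ep up} lp neq => // ->; rewrite eqxx.
Qed.

(** An induced leaf-rooted subtree of [G] is enlarged one vertex at a time until it covers [G]:
    connectedness supplies the next vertex, the degree bound the room for it, and acyclicity keeps
    the copy induced. *)
Lemma tree_leaf_rooted (G : sgraph) : is_tree G -> max_degree G <= 3 ->
  exists s (f : verts (Bin s Emp) -> G),
  bijective f /\ forall x y, adj (f x) (f y) = tadj x y.
Proof.
move=> [[G0 connG] acG] degG.
(* The root leaf is not counted by [nverts s], so the embedded tree has [n + 1] vertices. *)
suff H n : n < #|G| -> exists s (f : verts (Bin s Emp) -> G),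
    [/\ nverts s = n, injective f & forall x y, adj (f x) (f y) = tadj x y].
  have [|s [f [ss injf fa]]] := H #|G|.-1; first by rewrite prednK.
  exists s, f; split=> //; apply: inj_card_bij => //.
  by rewrite card_verts /= addn0 ss prednK.
elim: n => [|n IH] nG.
  have /card_gt0P[x0 _] := G0; exists Emp, (fun=> x0); split=> //.
    by move=> [[]|] // [[]|].
  by move=> [[]|] // [[]|] //=; rewrite adj_irr.
have [s [f [ss injf fa]]] := IH (ltnW nG).
have [v vf] : exists v, v \notin codom f.
  apply/existsP; apply: contraTT nG => /existsPn allf; rewrite -leqNgt -ss.
  have <- : #|verts (Bin s Emp)| = (nverts s).+1 by rewrite card_verts /= addn0.
  rewrite -(card_codom injf); apply/subset_leq_card/subsetP => v _.
  exact: negbNE (allf v).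
have [z [y [zy zf yf]]] :=
  connect_exit (P := mem (codom f)) (connG (f None) v) (codom_f f None) vf.
have [x zE] := codomP zf; rewrite {z zf}zE in zy.
have {}yf : y \notin codom f by [].
have [|u [h [bh ha hx]]] := @grow_leaf_rooted s x.
  (* Besides the images of the neighbours of [x], the vertex [f x] has the neighbour [y], so at most
     two neighbours lie in the tree. *)
  have [nb [unb anb <-]] := neighbours x.
  rewrite -ltnS; apply: leq_trans degG.
  apply: leq_trans (leq_bigmax (f x)); rewrite /degree.
  rewrite -(size_map f) -[X in X <= _]/(size (y :: map f nb)) cardE.
  apply: uniq_leq_size => [|w].
    rewrite /= map_inj_uniq // unb andbT; apply: contra yf => /mapP[z _ ->].
    exact: codom_f.
  rewrite inE mem_enum inE => /orP[/eqP-> //|/mapP[z znb ->]].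
  by rewrite fa; apply: (allP anb).
have [g hK gK] := bh.
exists u, (fun w => if g w is Some z then f z else y); split.
- have := bij_eq_card bh; rewrite card_option !card_verts /= ss; lia.
- move=> w w'; rewrite -{2}(gK w) -{2}(gK w').
  case: (g w) (g w') => [z|] [z'|] //; first by move/injf->.
    by move=> e; move: yf; rewrite -e codom_f.
  by move=> e; move: yf; rewrite e codom_f.
move=> w w'; rewrite -{2}(gK w) -{2}(gK w').
have attach z : adj (f z) y = (z == x).
  apply/idP/eqP => [az|-> //].
  exact: (acyclic_attach acG injf fa yf zy az).
case: (g w) (g w') => [z|] [z'|]; rewrite ?adj_irr ?tadj_irr // ?ha ?hx //.
  by rewrite tadj_sym hx attach.
by rewrite adj_sym attach.
Qed.

(** * Bounds on the nuclear norm *)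

Local Open Scope ring_scope.
Local Open Scope sesquilinear_scope.

Section NuclearNorm.
Variable C : numClosedFieldType.
Implicit Types (I J : finType).

Definition contraction I (x : I -> I -> C) : Prop :=
  forall v : I -> C, \sum_i `|\sum_j x i j * v j| ^+ 2 <= \sum_j `|v j| ^+ 2.

(* Dual and primal witnesses for bounds on the nuclear norm of [a]. *)
Definition nuclear_ge I (a : rel I) (b : C) : Prop :=
  exists2 x : I -> I -> C, contraction x &
    b <= \sum_i \sum_j (a i j)%:R * x i j.

Definition nuclear_le I (a : rel I) (b : C) : Prop :=
  exists m (e : 'I_m -> C) (w : 'I_m -> I -> C),
    (forall i j, (a i j)%:R = \sum_k e k * w k i * (w k j)^*) /\
    \sum_k `|e k| * (\sum_i `|w k i| ^+ 2) <= b.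

Lemma char_poly_similar n (A D P Q : 'M[C]_n) :
  Q *m P = 1%:M -> A = Q *m D *m P -> char_poly A = char_poly D.
Proof.
move=> QP ->; rewrite /char_poly /char_poly_mx.
have QP' : map_mx polyC Q *m map_mx polyC P = 1%:M by rewrite -map_mxM QP map_mx1.
have -> : 'X%:M - map_mx polyC (Q *m D *m P) =
    map_mx polyC Q *m ('X%:M - map_mx polyC D) *m map_mx polyC P.
  by rewrite mulmxBr mulmxBl !map_mxM scalar_mxC -(mulmxA 'X%:M) QP' mulmx1.
by rewrite !det_mulmx mulrAC -det_mulmx QP' det1 mul1r.
Qed.

(** The spectral theorem for real symmetric matrices with columns indexed by vertices: [d] lists the
    eigenvalues, [p] is the diagonalising unitary matrix. *)
Lemma spectral_decomposition (G : sgraph) :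
  exists n (d : 'I_n -> C) (p : 'I_n -> G -> C),
  [/\ energy C G = \sum_l `|d l|,
      forall l, \sum_x `|p l x| ^+ 2 = 1,
      forall x y, \sum_l (p l x)^* * p l y = (x == y)%:R,
      forall l, d l = \sum_x \sum_y p l x * (adj x y)%:R * (p l y)^* &
      forall x y, (adj x y)%:R = \sum_l (p l x)^* * d l * p l y].
Proof.
set A := adjacency_mx C G.
have symA : A \is symmetricmx.
  apply/is_hermitianmxP; rewrite expr0 scale1r map_mx_id //.
  by apply/matrixP=> i j; rewrite !mxE adj_sym.
have realA : A \is a mxOver Num.real.
  by apply/mxOverP => i j; rewrite mxE realn.
have /hermitian_normalmx/orthomx_spectralP := realsym_hermsym symA realA.
have := spectral_unitarymx A.
set P := spectralmx A; set D := spectral_diag A => uP.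
have unP := unitarymx_unit uP.
rewrite (invmx_unitary uP) => eqA.
have uP' : P *m P ^t* = 1%:M by exact/unitarymxP.
have uP'' : P ^t* *m P = 1%:M by rewrite -(invmx_unitary uP) mulVmx.
exists #|G|, (fun l => D 0 l), (fun l x => P l (enum_rank x)); split.
- rewrite /energy.
  (* The diagonal entries and the listed eigenvalues are the roots of the same characteristic
     polynomial, hence agree up to order. *)
  have -> : \sum_(l < #|G|) `|D 0 l| = \sum_(z <- [seq D 0 l | l <- enum 'I_#|G|]) `|z|.
    by rewrite big_map big_enum.
  apply: perm_big; apply: prod_XsubC_eq; rewrite -char_poly_eigenvalues.
  rewrite -/A (char_poly_similar uP'' eqA) char_poly_trig ?diag_mx_is_trig //.
  by rewrite big_map big_enum; apply: eq_bigr => l _; rewrite mxE eqxx.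
- move=> l; have /matrixP/(_ l l) := uP'; rewrite !mxE eqxx mulr1n => <-.
  rewrite (reindex _ (onW_bij _ (@enum_rank_bij G))) /=.
  by apply: eq_bigr => x _; rewrite !mxE normCK.
- move=> x y; have /matrixP/(_ (enum_rank x) (enum_rank y)) := uP''.
  rewrite !mxE (inj_eq enum_rank_inj) => <-.
  by apply: eq_bigr => l _; rewrite !mxE.
- move=> l.
  have /matrixP/(_ l l) : P *m A *m P ^t* = diag_mx D.
    by rewrite eqA !mulmxA uP' mul1mx -mulmxA uP' mulmx1.
  rewrite !mxE eqxx mulr1n => <-; rewrite exchange_big /=.
  rewrite (reindex _ (onW_bij _ (@enum_rank_bij G))) /=.
  apply: eq_bigr => y _; rewrite !mxE mulr_suml.
  rewrite (reindex _ (onW_bij _ (@enum_rank_bij G))) /=.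
  by apply: eq_bigr => x _; rewrite !mxE !enum_rankK.
- move=> x y; have /matrixP/(_ (enum_rank x) (enum_rank y)) := eqA.
  rewrite !mxE !enum_rankK => ->.
  by apply: eq_bigr => l _; rewrite mul_mx_diag !mxE.
Qed.

Lemma mulr_le_half_sqr (s t : C) :
  0 <= s -> 0 <= t -> s * t <= (s ^+ 2 + t ^+ 2) / 2%:R.
Proof.
move=> s0 t0; rewrite ler_pdivlMr ?ltr0n // -subr_ge0.
have -> : s ^+ 2 + t ^+ 2 - s * t * 2%:R = (s - t) ^+ 2 by ring.
by rewrite real_exprn_even_ge0 // rpredB // ger0_real.
Qed.

(** In the eigenbasis the trace pairing becomes the sum of the [d l * q l], where [q l] is the value
    of the quadratic form of [x] at a unit vector, so that [q l] has modulus at most 1 when [x] is a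
    contraction. *)
Lemma nuclear_ge_energy (G : sgraph) b :
  nuclear_ge (@adj G) b -> b \is Num.real -> b <= energy C G.
Proof.
case=> x cx le_b real_b.
have [n [d [p [-> np _ _ eqa]]]] := spectral_decomposition G.
pose q l := \sum_i (p l i)^* * \sum_j x i j * p l j.
have eqS : \sum_i \sum_j (adj i j)%:R * x i j = \sum_l d l * q l.
  under [RHS]eq_bigr do rewrite /q mulr_sumr.
  rewrite [RHS]exchange_big /=; apply: eq_bigr => i _.
  under [RHS]eq_bigr do rewrite mulr_sumr mulr_sumr.
  rewrite [RHS]exchange_big /=; apply: eq_bigr => j _; rewrite eqa mulr_suml.
  by apply: eq_bigr => l _; ring.
move: le_b; rewrite eqS => le_b.
(* The order on [C] is partial; comparability with the real [b] makes the sum real, so it is bounded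
   by its modulus. *)
have real_q : \sum_l d l * q l \is Num.real by rewrite (ger_real le_b).
apply: (le_trans le_b); apply: (le_trans (real_ler_norm real_q)).
apply: (le_trans (ler_norm_sum _ _ _)); apply: ler_sum => l _.
rewrite normrM ler_piMr //.
apply: (le_trans (ler_norm_sum _ _ _)).
pose y i := \sum_j x i j * p l j.
apply: (@le_trans _ _ (\sum_i (`|p l i| ^+ 2 + `|y i| ^+ 2) / 2%:R)).
  apply: ler_sum => i _; rewrite normrM norm_conjC; exact: mulr_le_half_sqr.
rewrite -mulr_suml ler_pdivrMr ?ltr0n // big_split /= np mul1r -[2%:R]/(1 + 1) lerD2l.
by rewrite -(np l); exact: cx.
Qed.

(** Each eigenvalue is a combination of the [e k] with the squared moduli of the coordinates of
    [w k] as weights. Summing moduli over the eigenbasis, these weights add up to the squared norm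
    of [w k] by Parseval. *)
Lemma nuclear_le_energy (G : sgraph) b :
  nuclear_le (@adj G) b -> energy C G <= b.
Proof.
case=> m [e [w [eqw le_b]]]; apply: le_trans le_b.
have [n [d [p [-> _ pp eqd _]]]] := spectral_decomposition G.
have eqd' l : d l = \sum_k e k * `|\sum_x p l x * w k x| ^+ 2.
  rewrite eqd; under [RHS]eq_bigr do
    rewrite normCK rmorph_sum mulr_suml mulr_sumr.
  rewrite [RHS]exchange_big /=; apply: eq_bigr => x _.
  under [RHS]eq_bigr do rewrite mulr_sumr mulr_sumr.
  rewrite [RHS]exchange_big /=; apply: eq_bigr => y _; rewrite eqw mulr_sumr mulr_suml.
  by apply: eq_bigr => k _; rewrite rmorphM /=; ring.
have isom k : \sum_l `|\sum_x p l x * w k x| ^+ 2 = \sum_x `|w k x| ^+ 2.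
  under eq_bigr do rewrite normCK rmorph_sum mulr_suml.
  rewrite exchange_big; apply: eq_bigr => x _.
  under eq_bigr do rewrite mulr_sumr.
  have inner y : \sum_l p l x * w k x * (p l y * w k y)^* =
      w k x * (w k y)^* * (y == x)%:R.
    rewrite -pp mulr_sumr; apply: eq_bigr => l _.
    by rewrite rmorphM /=; ring.
  rewrite exchange_big (bigD1 x) //= [X in _ + X]big1 => [|y /negbTE yx].
    by rewrite inner eqxx mulr1 addr0 -normCK.
  by rewrite inner yx mulr0.
under [X in _ <= X]eq_bigr do rewrite -isom mulr_sumr.
rewrite exchange_big; apply: ler_sum => l _; rewrite eqd'.
apply: (le_trans (ler_norm_sum _ _ _)); apply: ler_sum => k _.
by rewrite normrM (ger0_norm (exprn_ge0 _ _)).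
Qed.

(** The block diagonal witness vanishes on pairs from different blocks, so edges between the two
    pieces contribute nothing and the bounds add. *)
Lemma nuclear_ge_sum I J (K : finType) (f : I + J -> K) (a : rel I) (a' : rel J)
    (a'' : rel K) b b' :
  bijective f -> (forall x y, a'' (f (inl x)) (f (inl y)) = a x y) ->
  (forall x y, a'' (f (inr x)) (f (inr y)) = a' x y) ->
  nuclear_ge a b -> nuclear_ge a' b' -> nuclear_ge a'' (b + b').
Proof.
case=> g fK gK fl fr [x cx le_b] [x' cx' le_b'].
have bijf : bijective f by exists g.
pose y k k' := match g k, g k' with
  | inl i, inl i' => x i i' | inr j, inr j' => x' j j' | _, _ => 0 end.
have splitK (F : K -> C) :
    \sum_k F k = \sum_i F (f (inl i)) + \sum_j F (f (inr j)).
  by rewrite (reindex _ (onW_bij _ bijf)) big_sumType.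
exists y.
  move=> v; rewrite !splitK lerD //.
    apply: le_trans (cx (fun i => v (f (inl i)))).
    apply: ler_sum => i _; rewrite splitK [X in _ + X]big1 => [|j _].
      rewrite addr0 le_eqVlt; apply/orP; left; apply/eqP; congr (`|_| ^+ 2).
      by apply: eq_bigr => i' _; rewrite /y !fK.
    by rewrite /y !fK mul0r.
  apply: le_trans (cx' (fun j => v (f (inr j)))).
  apply: ler_sum => i _; rewrite splitK [X in X + _]big1 => [|j _].
    rewrite add0r le_eqVlt; apply/orP; left; apply/eqP; congr (`|_| ^+ 2).
    by apply: eq_bigr => i' _; rewrite /y !fK.
  by rewrite /y !fK mul0r.
apply: le_trans (lerD le_b le_b') _; rewrite splitK le_eqVlt; apply/orP; left.
apply/eqP; congr (_ + _); apply: eq_bigr => i _; rewrite splitK.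
  rewrite [X in _ + X]big1 => [|j _]; last by rewrite /y !fK mulr0.
  by rewrite addr0; apply: eq_bigr => j _; rewrite /y !fK fl.
rewrite [X in X + _]big1 => [|j _]; last by rewrite /y !fK mulr0.
by rewrite add0r; apply: eq_bigr => j _; rewrite /y !fK fr.
Qed.

Lemma nuclear_ge_iso I J (f : I -> J) (a : rel I) (a' : rel J) b :
  bijective f -> (forall x y, a' (f x) (f y) = a x y) ->
  nuclear_ge a b -> nuclear_ge a' b.
Proof.
move=> bijf fa [x cx le_b]; have [g fK gK] := bijf.
exists (fun i j => x (g i) (g j)).
  move=> v; rewrite !(reindex _ (onW_bij _ bijf)) /=.
  apply: le_trans (cx (v \o f)); apply: ler_sum => i _.
  rewrite le_eqVlt; apply/orP; left; apply/eqP; congr (`|_| ^+ 2).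
  by rewrite (reindex _ (onW_bij _ bijf)); apply: eq_bigr => j _; rewrite !fK.
apply: le_trans le_b _; rewrite le_eqVlt; apply/orP; left; apply/eqP.
rewrite [RHS](reindex _ (onW_bij _ bijf)); apply: eq_bigr => i _.
rewrite [RHS](reindex _ (onW_bij _ bijf)); apply: eq_bigr => j _.
by rewrite !fK fa.
Qed.

Lemma nuclear_le_iso I J (f : I -> J) (a : rel I) (a' : rel J) b :
  bijective f -> (forall x y, a' (f x) (f y) = a x y) ->
  nuclear_le a b -> nuclear_le a' b.
Proof.
move=> bijf fa [m [e [w [eqw le_b]]]]; have [g fK gK] := bijf.
exists m, e, (fun k j => w k (g j)); split=> [i j|].
  by rewrite -eqw -fa !gK.
apply: le_trans le_b; apply: ler_sum => k _; rewrite le_eqVlt; apply/orP; left.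
apply/eqP; congr (_ * _); rewrite (reindex _ (onW_bij _ bijf)) /=.
by apply: eq_bigr => i _; rewrite fK.
Qed.

(* The norm of the Gram matrix is at most its largest absolute row sum. *)
Lemma gram_contraction I (y : I -> I -> C) :
  (forall i j, y i j \is Num.real) ->
  (forall i, \sum_j `|\sum_k y k i * y k j| <= 1) -> contraction y.
Proof.
move=> realy gram v; pose g i j := \sum_k y k i * y k j.
have gC i j : g i j = g j i by apply: eq_bigr => k _; rewrite mulrC.
have eqS : \sum_i `|\sum_j y i j * v j| ^+ 2 =
    \sum_i \sum_j g i j * (v i * (v j)^*).
  under eq_bigr do rewrite normCK rmorph_sum mulr_suml.
  rewrite exchange_big; apply: eq_bigr => i _.
  under eq_bigr do rewrite mulr_sumr.
  rewrite exchange_big; apply: eq_bigr => j _; rewrite mulr_suml.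
  apply: eq_bigr => k _; rewrite rmorphM /= (CrealP (realy k j)); ring.
have realS : \sum_i \sum_j g i j * (v i * (v j)^*) \is Num.real.
  by rewrite -eqS; apply: rpred_sum => i _; rewrite rpredX // normr_real.
rewrite eqS.
apply: (le_trans (real_ler_norm realS)).
apply: (@le_trans _ _
    (\sum_i \sum_j `|g i j| * ((`|v i| ^+ 2 + `|v j| ^+ 2) / 2%:R))).
  apply: (le_trans (ler_norm_sum _ _ _)); apply: ler_sum => i _.
  apply: (le_trans (ler_norm_sum _ _ _)); apply: ler_sum => j _.
  rewrite !normrM norm_conjC; apply: ler_wpM2l => //.
  exact: mulr_le_half_sqr.
(* By symmetry of [g] the two halves have the same sum, which leaves the absolute row sums. *)
have -> : \sum_i \sum_j `|g i j| * ((`|v i| ^+ 2 + `|v j| ^+ 2) / 2%:R) =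
    \sum_i `|v i| ^+ 2 * \sum_j `|g i j|.
  pose h := \sum_i \sum_j `|g i j| * (`|v i| ^+ 2 / 2%:R).
  transitivity (h + h); last first.
    rewrite /h -big_split; apply: eq_bigr => i _; by rewrite /= -mulr_suml; field.
  have hC : h = \sum_i \sum_j `|g i j| * (`|v j| ^+ 2 / 2%:R).
    rewrite /h exchange_big; apply: eq_bigr => i _.
    by apply: eq_bigr => j _; rewrite gC.
  rewrite {2}hC /h -big_split; apply: eq_bigr => i _.
  by rewrite -big_split; apply: eq_bigr => j _ /=; rewrite -mulrDr -mulrDl.
by apply: ler_sum => i _; rewrite ler_piMr ?exprn_ge0 //; exact: gram.
Qed.

End NuclearNorm.

(** * Integer certificates *)

(** The checkers are written with the operations of [Z], which compute; this identifies them with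
    the ring operations in their correctness proofs. *)
Lemma Z_ringE : (Z.mul =2 *%R) * (Z.abs =1 Num.norm) * (Z.leb =2 <=%R).
Proof. by []. Qed.

Section IntegerCertificates.
Variable C : numClosedFieldType.

Definition ZtoC (z : Z) : C := (int_of_Z z)%:~R.

Fact ZtoC_additive : additive ZtoC.
Proof. by move=> x y; rewrite /ZtoC !raddfB. Qed.
HB.instance Definition _ := GRing.isAdditive.Build Z C ZtoC ZtoC_additive.

Fact ZtoC_multiplicative : multiplicative ZtoC.
Proof. by split=> [x y|]; rewrite /ZtoC ?rmorphM ?rmorph1. Qed.
HB.instance Definition _ :=
  GRing.isMultiplicative.Build Z C ZtoC ZtoC_multiplicative.

Lemma ler_ZtoC x y : (ZtoC x <= ZtoC y) = (x <= y).
Proof. by rewrite /ZtoC ler_int; apply/idP/idP; lia. Qed.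

Lemma ltr_ZtoC x y : (ZtoC x < ZtoC y) = (x < y).
Proof. by rewrite !lt_def ler_ZtoC /ZtoC eqr_int (can_eq int_of_ZK). Qed.

Lemma ZtoC_abs x : ZtoC (Z.abs x) = `|ZtoC x|.
Proof.
rewrite -[Z.abs x]/(`|x| : Z); have [x0|/ltW x0] := leP 0 x.
  by rewrite !ger0_norm // -(raddf0 ZtoC) ler_ZtoC.
by rewrite !ler0_norm ?raddfN // -(raddf0 ZtoC) ler_ZtoC.
Qed.

Lemma ZtoC_real x : ZtoC x \is Num.real.
Proof. exact: realz. Qed.

Lemma ZtoC_nat n : ZtoC (Z.of_nat n) = n%:R.
Proof. by rewrite -(rmorph_nat ZtoC); congr ZtoC; lia. Qed.

Lemma ZtoC_1000 : ZtoC 1000 = 1000%:R.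
Proof. by rewrite -ZtoC_nat. Qed.

(** A sum over the vertices that computes by recursion on the tree. *)
Fixpoint tsum t : (verts t -> Z) -> Z :=
  match t with
  | Emp => fun _ => Z0
  | Bin l r => fun F : option (verts l + verts r) -> Z =>
      Z.add (F None) (Z.add (tsum (fun v => F (Some (inl v))))
                            (tsum (fun v => F (Some (inr v)))))
  end.

Lemma tsumE t (F : verts t -> Z) : tsum F = \sum_x F x.
Proof.
elim: t F => [|l IHl r IHr] F /=; first by rewrite big_pred0 // => -[].
rewrite IHl IHr (bigD1 None) //= (reindex_omap Some id) => [|[]] //=.
by under [X in _ = _ + X]eq_bigl do rewrite eqxx; rewrite big_sumType.
Qed.

(** Fixes the order of rows and columns in the certificates. *)
Fixpoint preorder t : verts t -> nat :=
  match t with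
  | Emp => fun _ => 0%N
  | Bin l r => fun x : option (verts l + verts r) =>
    match x with
    | None => 0%N
    | Some (inl v) => (preorder v).+1
    | Some (inr v) => (nverts l + preorder v).+1
    end
  end.

Definition lookup (Y : seq (seq Z)) i j := nth Z0 (nth [::] Y i) j.

(** A quantifier over the vertices that computes, by counting the failures. *)
Definition tall t (P : verts t -> bool) :=
  Z.eqb (tsum (fun x => if P x then Z0 else Z.pos xH)) Z0.

Lemma tallP t (P : verts t -> bool) : tall P -> forall x, P x.
Proof.
rewrite /tall tsumE -[Z.eqb _ _]/(_ == 0 :> Z) psumr_eq0 => [/allP h x|x _].
  by have := h x (mem_index_enum x); case: (P x).
by case: ifP.
Qed.

(* [Y / d] is a contraction because the row sums of the absolute values of
   Y^T Y, which bound its norm, are at most d^2; bounds on the energy are in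
   thousandths. *)
Definition lower_cert t (d : Z) (Y : seq (seq Z)) (b : Z) : bool :=
  let y (i j : verts t) := lookup Y (preorder i) (preorder j) in
  [&& Z.ltb Z0 d,
    tall (fun i => Z.leb
      (tsum (fun j => Z.abs (tsum (fun k => Z.mul (y k i) (y k j)))))
      (Z.mul d d))
    & Z.leb (Z.mul b d)
        (Z.mul 1000 (tsum (fun i => tsum (fun j => if tadj i j then y i j else Z0))))].

Lemma lower_certP t d Y b :
  lower_cert t d Y b -> nuclear_ge (@tadj t) (ZtoC b / 1000%:R).
Proof.
rewrite /lower_cert => /and3P[d0 /tallP gram le_b].
pose y (i j : verts t) := lookup Y (preorder i) (preorder j).
have {}gram i : Z.leb (tsum (fun j : verts t =>
    Z.abs (tsum (fun k => Z.mul (y k i) (y k j))))) (Z.mul d d) := gram i.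
have {}le_b : Z.leb (Z.mul b d) (Z.mul 1000 (tsum (fun i : verts t =>
    tsum (fun j => if tadj i j then y i j else Z0)))) := le_b.
have {}d0 : 0 < ZtoC d by rewrite -(raddf0 ZtoC) ltr_ZtoC.
have dn0 : ZtoC d != 0 by rewrite gt_eqF.
move: le_b; rewrite !Z_ringE tsumE => le_b.
exists (fun i j => ZtoC (y i j) / ZtoC d).
  apply: gram_contraction => [i j|i]; first by rewrite realM ?realV ?ZtoC_real.
  have := gram i; rewrite Z_ringE -ler_ZtoC tsumE Z_ringE rmorphM.
  rewrite rmorph_sum => le_d.
  rewrite -(@ler_pM2r _ (ZtoC d * ZtoC d)) ?mulr_gt0 // mul1r mulr_suml.
  apply: le_trans le_d; apply: ler_sum => j _.
  rewrite /= ZtoC_abs tsumE rmorph_sum le_eqVlt.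
  apply/orP; left; apply/eqP.
  rewrite -[ZtoC d * ZtoC d]gtr0_norm ?mulr_gt0 // -normrM mulr_suml.
  congr (`|_|); apply: eq_bigr => k _; rewrite Z_ringE rmorphM /=; field.
  by rewrite dn0.
rewrite ler_pdivrMr ?ltr0n // -(ler_pM2r d0) -!rmorphM.
move: le_b; rewrite -ler_ZtoC !rmorphM rmorph_sum => /le_trans; apply.
rewrite le_eqVlt; apply/orP; left; apply/eqP.
rewrite !mulr_suml mulr_sumr; apply: eq_bigr => i _.
rewrite tsumE rmorph_sum !mulr_suml mulr_sumr; apply: eq_bigr => j _.
rewrite /= ZtoC_1000.
by case: tadj; rewrite ?raddf0 ?mul1r ?mul0r ?mulr0 //; field; rewrite dn0.
Qed.

(* d A = \sum_k c_k w_k w_k^T for the pairs (c_k, w_k) in [ws]. *)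
Definition upper_cert t (d : Z) (ws : seq (Z * seq Z)) (b : Z) : bool :=
  let w (cw : Z * seq Z) (i : verts t) := nth Z0 cw.2 (preorder i) in
  [&& Z.ltb Z0 d,
    tall (fun i : verts t => tall (fun j => Z.eqb (if tadj i j then d else Z0)
      (foldr (fun cw s => Z.add (Z.mul (Z.mul cw.1 (w cw i)) (w cw j)) s) Z0 ws)))
    & Z.leb (Z.mul 1000 (foldr (fun cw s => Z.add (Z.mul (Z.abs cw.1)
        (tsum (fun i => Z.mul (w cw i) (w cw i)))) s) Z0 ws)) (Z.mul b d)].

Lemma upper_certP t d ws b :
  upper_cert t d ws b -> nuclear_le (@tadj t) (ZtoC b / 1000%:R).
Proof.
rewrite /upper_cert => /and3P[d0 /tallP eqA le_b].
pose w (cw : Z * seq Z) (i : verts t) := nth Z0 cw.2 (preorder i).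
have {}le_b : Z.leb (Z.mul 1000 (foldr (fun cw s => Z.add (Z.mul (Z.abs cw.1)
    (tsum (fun i => Z.mul (w cw i) (w cw i)))) s) Z0 ws)) (Z.mul b d) := le_b.
have {}d0 : 0 < ZtoC d by rewrite -(raddf0 ZtoC) ltr_ZtoC.
have dn0 : ZtoC d != 0 by rewrite gt_eqF.
have foldE (F : Z * seq Z -> Z) s :
    foldr (fun cw => Z.add (F cw)) Z0 s =
    \sum_(k < size s) F (nth (Z0, [::]) s k).
  elim: s => [|cw s IH] /=; first by rewrite big_ord0.
  by rewrite big_ord_recl IH.
rewrite (foldE (fun cw => Z.mul (Z.abs cw.1) _)) !Z_ringE in le_b.
exists (size ws), (fun k => ZtoC (nth (Z0, [::]) ws k).1 / ZtoC d),
  (fun k i => ZtoC (w (nth (Z0, [::]) ws k) i)); split=> [i j|].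
  have /eqP := tallP (eqA i) j.
  rewrite (foldE (fun cw => Z.mul (Z.mul cw.1 _) _)).
  move=> /(congr1 ZtoC); rewrite rmorph_sum /= => e.
  apply: (mulIf dn0); transitivity (ZtoC (if tadj i j then d else Z0)).
    by case: tadj; rewrite ?mul1r ?mul0r ?raddf0.
  rewrite e mulr_suml; apply: eq_bigr => k _.
  rewrite !rmorphM /= (CrealP (ZtoC_real _)); field.
  by rewrite dn0.
rewrite ler_pdivlMr ?ltr0n // -(ler_pM2r d0) -rmorphM.
move: le_b; rewrite -ler_ZtoC; apply: le_trans.
rewrite rmorphM rmorph_sum /= le_eqVlt; apply/orP; left; apply/eqP.
rewrite ZtoC_1000.
rewrite mulrAC mulrC; congr (_ * _); rewrite mulr_suml.
apply: eq_bigr => k _; rewrite rmorphM /= ZtoC_abs.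
rewrite normrM normfV (gtr0_norm d0) tsumE rmorph_sum.
under eq_bigr do rewrite -ZtoC_abs -rmorphXn.
rewrite mulrAC mulfVK //; congr (_ * _); apply: eq_bigr => i _.
by rewrite /= -normrX ger0_norm ?sqr_ge0.
Qed.

End IntegerCertificates.

Notation certificate := (btree * Z * Z * seq (seq Z))%type.
(** The certified tree is [Bin (cbody e) Emp]; index 0 of the matrix is its root leaf. *)
Definition cbody (e : certificate) := e.1.1.1.
Definition cdenom (e : certificate) := e.1.1.2.
Definition cbound (e : certificate) := e.1.2.
Definition cmatrix (e : certificate) := e.2.

(* The matrices are rounded multiples of the sign of A, completed by the identity
   or its opposite on the kernel of A to make them nearly orthogonal, as the row
   sum test requires. For K_2 and Q they are exact. *)
Local Open Scope Z_scope.
Definition certificates : seq certificate := [::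
  (leaf, 1, 2000,
    [:: [:: 0; 1]; [:: 1; 0]]);
  (Bin leaf Emp, 1000, 2828,
    [:: [:: 500; 707; -500]; [:: 707; 0; 707]; [:: -500; 707; 500]]);
  (Bin (Bin leaf Emp) Emp, 6, 4333,
    [:: [:: 0; 5; 0; -3]; [:: 5; 0; 3; 0]; [:: 0; 3; 0; 5]; [:: -3; 0; 5; 0]]);
  (stalk, 71, 5183,
    [:: [:: 0; 65; 0; -19; -19]; [:: 65; 0; 27; 0; 0];
        [:: 0; 27; 0; 46; 46]; [:: -19; 0; 46; 35; -35];
        [:: -19; 0; 46; -35; 35]]);
  (Bin (Bin (Bin leaf Emp) Emp) Emp, 11, 5090,
    [:: [:: 3; 8; -3; -2; 3]; [:: 8; 0; 6; 0; -2]; [:: -3; 6; 3; 6; -3];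
        [:: -2; 0; 6; 0; 8]; [:: 3; -2; -3; 8; 3]]);
  (Bin stalk Emp, 41, 6048,
    [:: [:: 16; 30; -16; -6; 8; 8]; [:: 30; 0; 25; 0; -6; -6];
        [:: -16; 25; 16; 19; -8; -8]; [:: -6; 0; 19; 0; 25; 25];
        [:: 8; -6; -8; 25; 24; -16]; [:: 8; -6; -8; 25; -16; 24]]);
  (Bin cherry leaf, 6, 6000,
    [:: [:: 3; 4; 0; -1; -1; -3]; [:: 4; 0; 2; 0; 0; 4];
        [:: 0; 2; 0; 4; 4; 0]; [:: -1; 0; 4; 3; -3; -1];
        [:: -1; 0; 4; -3; 3; -1]; [:: -3; 4; 0; -1; -1; 3]]);
  (Bin double_cherry Emp, 62, 9193,
    [:: [:: 20; 48; -20; -7; 10; 10; -7; 10; 10];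
        [:: 48; 0; 33; 0; -7; -7; 0; -7; -7];
        [:: -20; 33; 20; 26; -10; -10; 26; -10; -10];
        [:: -7; 0; 26; 0; 38; 38; 0; -5; -5];
        [:: 10; -7; -10; 38; 35; -25; -5; 5; 5];
        [:: 10; -7; -10; 38; -25; 35; -5; 5; 5];
        [:: -7; 0; 26; 0; -5; -5; 0; 38; 38];
        [:: 10; -7; -10; -5; 5; 5; 38; 35; -25];
        [:: 10; -7; -10; -5; 5; 5; 38; -25; 35]]);
  (Bin (Bin (Bin stalk Emp) Emp) leaf, 202, 9346,
    [:: [:: 117; 124; -33; -33; 33; 9; -17; -17; -83];
        [:: 124; 0; 91; 0; -24; 0; 9; 9; 124];
        [:: -33; 91; 67; 133; -67; -24; 33; 33; -33];
        [:: -33; 0; 133; 0; 133; 0; -33; -33; -33];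
        [:: 33; -24; -67; 133; 67; 91; -33; -33; 33];
        [:: 9; 0; -24; 0; 91; 0; 124; 124; 9];
        [:: -17; 9; 33; -33; -33; 124; 117; -83; -17];
        [:: -17; 9; 33; -33; -33; 124; -83; 117; -17];
        [:: -83; 124; -33; -33; 33; 9; -17; -17; 117]]);
  (Bin (Bin (Bin cherry leaf) Emp) leaf, 61, 9213,
    [:: [:: 36; 37; -12; -8; 0; 3; 3; 12; -24];
        [:: 37; 0; 29; 0; -2; 0; 0; -8; 37];
        [:: -12; 29; 24; 35; 0; -8; -8; -24; -12];
        [:: -8; 0; 35; 0; 20; 0; 0; 43; -8];
        [:: 0; -2; 0; 20; 0; 40; 40; 0; 0];
        [:: 3; 0; -8; 0; 40; 30; -30; -11; 3];
        [:: 3; 0; -8; 0; 40; -30; 30; -11; 3];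
        [:: 12; -8; -24; 43; 0; -11; -11; 24; 12];
        [:: -24; 37; -12; -8; 0; 3; 3; 12; 36]]);
  (Bin (Bin (Bin stalk leaf) Emp) Emp, 27, 9259,
    [:: [:: 10; 20; -10; -4; 4; 1; -2; -2; 6];
        [:: 20; 0; 16; 0; -3; 0; 1; 1; -4];
        [:: -10; 16; 10; 13; -4; -2; 2; 2; -6];
        [:: -4; 0; 13; 0; 14; 0; -3; -3; 17];
        [:: 4; -3; -4; 14; 12; 13; -6; -6; -8];
        [:: 1; 0; -2; 0; 13; 0; 16; 16; -3];
        [:: -2; 1; 2; -3; -6; 16; 16; -10; 4];
        [:: -2; 1; 2; -3; -6; 16; -10; 16; 4];
        [:: 6; -4; -6; 17; -8; -3; 4; 4; 14]]);
  (Bin double_cherry leaf, 81, 10074,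
    [:: [:: 48; 50; -16; -7; 8; 8; -7; 8; 8; -32];
        [:: 50; 0; 36; 0; -7; -7; 0; -7; -7; 50];
        [:: -16; 36; 32; 36; -16; -16; 36; -16; -16; -16];
        [:: -7; 0; 36; 0; 50; 50; 0; -7; -7; -7];
        [:: 8; -7; -16; 50; 48; -32; -7; 8; 8; 8];
        [:: 8; -7; -16; 50; -32; 48; -7; 8; 8; 8];
        [:: -7; 0; 36; 0; -7; -7; 0; 50; 50; -7];
        [:: 8; -7; -16; -7; 8; 8; 50; 48; -32; 8];
        [:: 8; -7; -16; -7; 8; 8; 50; -32; 48; 8];
        [:: -32; 50; -16; -7; 8; 8; -7; 8; 8; 48]]);
  (Bin (Bin (Bin stalk leaf) Emp) leaf, 303, 10092,
    [:: [:: 186; 182; -71; -34; 29; 9; -14; -14; 43; -114];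
        [:: 182; 0; 148; 0; -25; 0; 9; 9; -34; 182];
        [:: -71; 148; 143; 157; -57; -25; 29; 29; -86; -71];
        [:: -34; 0; 157; 0; 157; 0; -34; -34; 191; -34];
        [:: 29; -25; -57; 157; 143; 148; -71; -71; -86; 29];
        [:: 9; 0; -25; 0; 148; 0; 182; 182; -34; 9];
        [:: -14; 9; 29; -34; -71; 182; 186; -114; 43; -14];
        [:: -14; 9; 29; -34; -71; 182; -114; 186; 43; -14];
        [:: 43; -34; -86; 191; -86; -34; 43; 43; 171; 43];
        [:: -114; 182; -71; -34; 29; 9; -14; -14; 43; 186]]);
  (Bin (Bin double_cherry Emp) leaf, 41, 11414,
    [:: [:: 20; 26; 0; -9; 0; 4; 4; 0; 4; 4; -20];
        [:: 26; 0; 17; 0; -2; 0; 0; -2; 0; 0; 26];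
        [:: 0; 17; 0; 31; 0; -9; -9; 0; -9; -9; 0];
        [:: -9; 0; 31; 0; 15; 0; 0; 15; 0; 0; -9];
        [:: 0; -2; 0; 15; 0; 26; 26; 0; -2; -2; 0];
        [:: 4; 0; -9; 0; 26; 20; -20; -2; 0; 0; 4];
        [:: 4; 0; -9; 0; 26; -20; 20; -2; 0; 0; 4];
        [:: 0; -2; 0; 15; 0; -2; -2; 0; 26; 26; 0];
        [:: 4; 0; -9; 0; -2; 0; 0; 26; 20; -20; 4];
        [:: 4; 0; -9; 0; -2; 0; 0; 26; -20; 20; 4];
        [:: -20; 26; 0; -9; 0; 4; 4; 0; 4; 4; 20]]);
  (Bin (Bin (Bin double_cherry leaf) Emp) leaf, 204, 13205,
    [:: [:: 123; 122; -46; -24; 15; 5; -8; -8; 5; -8; -8; 31; -77];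
        [:: 122; 0; 98; 0; -14; 0; 5; 5; 0; 5; 5; -24; 122];
        [:: -46; 98; 92; 107; -31; -14; 15; 15; -14; 15; 15; -62; -46];
        [:: -24; 0; 107; 0; 93; 0; -19; -19; 0; -19; -19; 131; -24];
        [:: 15; -14; -31; 93; 77; 89; -38; -38; 89; -38; -38; -46; 15];
        [:: 5; 0; -14; 0; 89; 0; 124; 124; 0; -17; -17; -19; 5];
        [:: -8; 5; 15; -19; -38; 124; 119; -81; -17; 19; 19; 23; -8];
        [:: -8; 5; 15; -19; -38; 124; -81; 119; -17; 19; 19; 23; -8];
        [:: 5; 0; -14; 0; 89; 0; -17; -17; 0; 124; 124; -19; 5];
        [:: -8; 5; 15; -19; -38; -17; 19; 19; 124; 119; -81; 23; -8];
        [:: -8; 5; 15; -19; -38; -17; 19; 19; 124; -81; 119; 23; -8];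
        [:: 31; -24; -62; 131; -46; -19; 23; 23; -19; 23; 23; 108; 31];
        [:: -77; 122; -46; -24; 15; 5; -8; -8; 5; -8; -8; 31; 123]]);
  (Bin (Bin (Bin stalk stalk) Emp) leaf, 202, 13396,
    [:: [:: 122; 122; -44; -25; 22; 6; -11; -11; 22; 6; -11; -11; -78];
        [:: 122; 0; 97; 0; -18; 0; 6; 6; -18; 0; 6; 6; 122];
        [:: -44; 97; 89; 110; -44; -18; 22; 22; -44; -18; 22; 22; -44];
        [:: -25; 0; 110; 0; 110; 0; -25; -25; 110; 0; -25; -25; -25];
        [:: 22; -18; -44; 110; 89; 97; -44; -44; -44; -18; 22; 22; 22];
        [:: 6; 0; -18; 0; 97; 0; 122; 122; -18; 0; 6; 6; 6];
        [:: -11; 6; 22; -25; -44; 122; 122; -78; 22; 6; -11; -11; -11];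
        [:: -11; 6; 22; -25; -44; 122; -78; 122; 22; 6; -11; -11; -11];
        [:: 22; -18; -44; 110; -44; -18; 22; 22; 89; 97; -44; -44; 22];
        [:: 6; 0; -18; 0; -18; 0; 6; 6; 97; 0; 122; 122; 6];
        [:: -11; 6; 22; -25; 22; 6; -11; -11; -44; 122; 122; -78; -11];
        [:: -11; 6; 22; -25; 22; 6; -11; -11; -44; 122; -78; 122; -11];
        [:: -78; 122; -44; -25; 22; 6; -11; -11; 22; 6; -11; -11; 122]]);
  (Bin (Bin (Bin (Bin (Bin stalk leaf) Emp) leaf) Emp) leaf, 93, 13075,
    [:: [:: 56; 55; -21; -10; 8; 3; -3; -1; 2; 2; -5; 13; -34];
        [:: 55; 0; 44; 0; -7; 0; 2; 0; -1; -1; 3; -10; 55];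
        [:: -21; 44; 43; 47; -16; -8; 7; 2; -3; -3; 10; -26; -21];
        [:: -10; 0; 47; 0; 46; 0; -8; 0; 3; 3; -11; 57; -10];
        [:: 8; -7; -16; 46; 41; 46; -16; -7; 8; 8; -25; -25; 8];
        [:: 3; 0; -8; 0; 46; 0; 47; 0; -10; -10; 57; -11; 3];
        [:: -3; 2; 7; -8; -16; 47; 43; 44; -21; -21; -26; 10; -3];
        [:: -1; 0; 2; 0; -7; 0; 44; 0; 55; 55; -10; 3; -1];
        [:: 2; -1; -3; 3; 8; -10; -21; 55; 56; -34; 13; -5; 2];
        [:: 2; -1; -3; 3; 8; -10; -21; 55; -34; 56; 13; -5; 2];
        [:: -5; 3; 10; -11; -25; 57; -26; -10; 13; 13; 51; 15; -5];
        [:: 13; -10; -26; 57; -25; -11; 10; 3; -5; -5; 15; 51; 13];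
        [:: -34; 55; -21; -10; 8; 3; -3; -1; 2; 2; -5; 13; 56]]);
  (Bin (Bin (Bin double_cherry cherry) cherry) leaf, 73, 18273,
    [:: [:: 39; 44; -9; -10; 9; 2; -4; -4; 2; -4; -4; 0; 4; 4; -5; 4; 4; -31];
        [:: 44; 0; 29; 0; -6; 0; 2; 2; 0; 2; 2; -2; 0; 0; 0; -5; -5; 44];
        [:: -9; 29; 18; 41; -17; -6; 9; 9; -6; 9; 9; 0; -10; -10; 29; -9; -9; -9];
        [:: -10; 0; 41; 0; 41; 0; -10; -10; 0; -10; -10; 25; 0; 0; 0; -10; -10; -10];
        [:: 9; -6; -17; 41; 18; 29; -9; -9; 29; -9; -9; 0; -10; -10; -6; 9; 9; 9];
        [:: 2; 0; -6; 0; 29; 0; 44; 44; 0; -5; -5; -2; 0; 0; 0; 2; 2; 2];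
        [:: -4; 2; 9; -10; -9; 44; 39; -31; -5; 4; 4; 0; 4; 4; 2; -4; -4; -4];
        [:: -4; 2; 9; -10; -9; 44; -31; 39; -5; 4; 4; 0; 4; 4; 2; -4; -4; -4];
        [:: 2; 0; -6; 0; 29; 0; -5; -5; 0; 44; 44; -2; 0; 0; 0; 2; 2; 2];
        [:: -4; 2; 9; -10; -9; -5; 4; 4; 44; 39; -31; 0; 4; 4; 2; -4; -4; -4];
        [:: -4; 2; 9; -10; -9; -5; 4; 4; 44; -31; 39; 0; 4; 4; 2; -4; -4; -4];
        [:: 0; -2; 0; 25; 0; -2; 0; 0; -2; 0; 0; 0; 46; 46; -2; 0; 0; 0];
        [:: 4; 0; -10; 0; -10; 0; 4; 4; 0; 4; 4; 46; 35; -35; 0; 4; 4; 4];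
        [:: 4; 0; -10; 0; -10; 0; 4; 4; 0; 4; 4; 46; -35; 35; 0; 4; 4; 4];
        [:: -5; 0; 29; 0; -6; 0; 2; 2; 0; 2; 2; -2; 0; 0; 0; 44; 44; -5];
        [:: 4; -5; -9; -10; 9; 2; -4; -4; 2; -4; -4; 0; 4; 4; 44; 39; -31; 4];
        [:: 4; -5; -9; -10; 9; 2; -4; -4; 2; -4; -4; 0; 4; 4; 44; -31; 39; 4];
        [:: -31; 44; -9; -10; 9; 2; -4; -4; 2; -4; -4; 0; 4; 4; -5; 4; 4; 39]]);
  (Bin (Bin (Bin double_cherry double_cherry) cherry) leaf, 84, 22142,
    [:: [:: 47; 50; -13; -9; 7; 2; -3; -3; 2; -3; -3; 7; 2; -3; -3; 2; -3; -3; -6; 7; 7; -33];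
        [:: 50; 0; 34; 0; -6; 0; 2; 2; 0; 2; 2; -6; 0; 2; 2; 0; 2; 2; 0; -6; -6; 50];
        [:: -13; 34; 27; 42; -13; -6; 7; 7; -6; 7; 7; -13; -6; 7; 7; -6; 7; 7; 34; -13; -13; -13];
        [:: -9; 0; 42; 0; 42; 0; -9; -9; 0; -9; -9; 42; 0; -9; -9; 0; -9; -9; 0; -9; -9; -9];
        [:: 7; -6; -13; 42; 27; 34; -13; -13; 34; -13; -13; -13; -6; 7; 7; -6; 7; 7; -6; 7; 7; 7];
        [:: 2; 0; -6; 0; 34; 0; 50; 50; 0; -6; -6; -6; 0; 2; 2; 0; 2; 2; 0; 2; 2; 2];
        [:: -3; 2; 7; -9; -13; 50; 47; -33; -6; 7; 7; 7; 2; -3; -3; 2; -3; -3; 2; -3; -3; -3];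
        [:: -3; 2; 7; -9; -13; 50; -33; 47; -6; 7; 7; 7; 2; -3; -3; 2; -3; -3; 2; -3; -3; -3];
        [:: 2; 0; -6; 0; 34; 0; -6; -6; 0; 50; 50; -6; 0; 2; 2; 0; 2; 2; 0; 2; 2; 2];
        [:: -3; 2; 7; -9; -13; -6; 7; 7; 50; 47; -33; 7; 2; -3; -3; 2; -3; -3; 2; -3; -3; -3];
        [:: -3; 2; 7; -9; -13; -6; 7; 7; 50; -33; 47; 7; 2; -3; -3; 2; -3; -3; 2; -3; -3; -3];
        [:: 7; -6; -13; 42; -13; -6; 7; 7; -6; 7; 7; 27; 34; -13; -13; 34; -13; -13; -6; 7; 7; 7];
        [:: 2; 0; -6; 0; -6; 0; 2; 2; 0; 2; 2; 34; 0; 50; 50; 0; -6; -6; 0; 2; 2; 2];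
        [:: -3; 2; 7; -9; 7; 2; -3; -3; 2; -3; -3; -13; 50; 47; -33; -6; 7; 7; 2; -3; -3; -3];
        [:: -3; 2; 7; -9; 7; 2; -3; -3; 2; -3; -3; -13; 50; -33; 47; -6; 7; 7; 2; -3; -3; -3];
        [:: 2; 0; -6; 0; -6; 0; 2; 2; 0; 2; 2; 34; 0; -6; -6; 0; 50; 50; 0; 2; 2; 2];
        [:: -3; 2; 7; -9; 7; 2; -3; -3; 2; -3; -3; -13; -6; 7; 7; 50; 47; -33; 2; -3; -3; -3];
        [:: -3; 2; 7; -9; 7; 2; -3; -3; 2; -3; -3; -13; -6; 7; 7; 50; -33; 47; 2; -3; -3; -3];
        [:: -6; 0; 34; 0; -6; 0; 2; 2; 0; 2; 2; -6; 0; 2; 2; 0; 2; 2; 0; 50; 50; -6];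
        [:: 7; -6; -13; -9; 7; 2; -3; -3; 2; -3; -3; 7; 2; -3; -3; 2; -3; -3; 50; 47; -33; 7];
        [:: 7; -6; -13; -9; 7; 2; -3; -3; 2; -3; -3; 7; 2; -3; -3; 2; -3; -3; 50; -33; 47; 7];
        [:: -33; 50; -13; -9; 7; 2; -3; -3; 2; -3; -3; 7; 2; -3; -3; 2; -3; -3; -6; 7; 7; 47]])].
Local Close Scope Z_scope.

Lemma certificates_valid :
  all (fun e => lower_cert (Bin (cbody e) Emp) (cdenom e) (cmatrix e) (cbound e))
    certificates.
Proof. by lazy. Qed.

(** * Finite checks *)

(* The energy of [t] is larger than [c], seen by repeatedly cutting off pieces
   listed in [certificates]. *)
Fixpoint exceeds fuel (c : Z) t : bool :=
  has (fun e => Z.ltb c (cbound e) && rerooted t (cbody e)) certificates ||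
  if fuel is fuel'.+1 then
    has_prune (fun t' u => has (fun e => rerooted u (cbody e) &&
      exceeds fuel' (Z.sub c (cbound e)) t') certificates) t
  else false.

(* Both lists contain the trees [s] for which [Bin s Emp] has the property. *)
Definition exceptional := [:: Emp; Bin leaf Emp; cherry; Bin stalk leaf].
Definition critical := [:: leaf; Bin cherry leaf].

(** Bounds are in thousandths, and up to four pieces may be cut off before the rest has to be
    certified. *)
Definition surplus_cert t := exceeds 4 (Z.mul 1000 (Z.of_nat (nverts t))) t.

Definition settled s :=
  has (sim s) exceptional || has (sim s) critical || surplus_cert (Bin s Emp).

(* Call by need: [vm_compute] would evaluate both sides of each disjunction. *)
Lemma stuck_settled : all settled stuck.
Proof. by lazy. Qed.

(** For an exceptional remainder, with energy below its order, the bounds of the pieces need not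
    suffice, so the reassembled trees are checked one by one. *)
Lemma graft_exceptional_settled :
  all (fun e => all (all_graft settled e) cuts) exceptional.
Proof. by lazy. Qed.

(** Here [Bin leaf Emp] is read as a whole tree and is K_2, which is tight. *)
Lemma cuts_surplus :
  all (fun u => sim u (Bin leaf Emp) || surplus_cert u) cuts.
Proof. by lazy. Qed.

(** The case where both pieces are tight, so that adding their bounds gives no strict inequality:
    K_2 is cut off and K_2 or Q remains. *)
Lemma graft_critical_settled :
  all (fun e => all_graft settled e (Bin leaf Emp)) critical.
Proof. by lazy. Qed.

(** * Upper bounds for the exceptional and critical trees *)

(* A star with centre c and leaf set L has
   2 p q A = (q c + p L) (q c + p L)^T - (q c - p L) (q c - p L)^T,
   and q / p approximates the square root of |L|; the fourth tree is the union of
   two stars. The last two entries are spectral decompositions. *)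
Local Open Scope Z_scope.
Definition upper_bounds : seq (btree * Z * seq (Z * seq Z) * Z) := [::
  (Emp, 1, [::], 999);
  (Bin leaf Emp, 12, [:: (1, [:: 2; 3; 2]); (-1, [:: 2; -3; 2])], 2999);
  (cherry, 4, [:: (1, [:: 1; 2; 1; 1]); (-1, [:: 1; -2; 1; 1])], 3999);
  (Bin stalk leaf, 30,
    [:: (1, [:: 3; 5; 3; 0; 0; 0; 3]); (-1, [:: 3; -5; 3; 0; 0; 0; 3]);
        (1, [:: 0; 0; 3; 5; 3; 3; 0]); (-1, [:: 0; 0; 3; -5; 3; 3; 0])], 6999);
  (leaf, 2, [:: (1, [:: 1; 1]); (-1, [:: 1; -1])], 2000);
  (Bin cherry leaf, 6,
    [:: (1, [:: 1; 2; 2; 1; 1; 1]); (-1, [:: 1; -2; 2; -1; -1; 1]);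
        (1, [:: 1; 1; -1; -1; -1; 1]); (-1, [:: 1; -1; -1; 1; 1; 1])], 6000)].
Local Close Scope Z_scope.

Lemma upper_bounds_valid :
  all (fun e => upper_cert (Bin e.1.1.1 Emp) e.1.1.2 e.1.2 e.2) upper_bounds.
Proof. by vm_compute. Qed.

(** * Energy of leaf-rooted binary trees *)

Section TreeEnergy.
Variable C : numClosedFieldType.

Lemma nuclear_ge_prune t t' u (b b' : C) : prune t t' u ->
  nuclear_ge (@tadj t') b -> nuclear_ge (@tadj u) b' ->
  nuclear_ge (@tadj t) (b + b').
Proof.
move=> /prune_verts[f [bf fl fr _]] lt' lu.
exact: (nuclear_ge_sum bf fl fr lt' lu).
Qed.

Lemma nuclear_ge_tiso t u (b : C) : tiso t u ->
  nuclear_ge (@tadj t) b -> nuclear_ge (@tadj u) b.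
Proof. by move=> [f bf af]; exact: nuclear_ge_iso af. Qed.

Lemma certificate_nuclear_ge e t : e \in certificates -> rerooted t (cbody e) ->
  nuclear_ge (@tadj t) (ZtoC C (cbound e) / 1000%:R).
Proof.
move=> ec /rerootedP iso; apply: nuclear_ge_tiso iso _.
exact: (lower_certP C (allP certificates_valid e ec)).
Qed.

Lemma exceedsP fuel c t : exceeds fuel c t ->
  exists2 b : C, ZtoC C c / 1000%:R < b & nuclear_ge (@tadj t) b.
Proof.
elim: fuel c t => [|fuel IH] c t; rewrite [exceeds _ _ _]/(_ || _) => /orP[] //.
1,2: move=> /hasP[e ec /andP[lt_c st]].
1,2: exists (ZtoC C (cbound e) / 1000%:R); last exact: certificate_nuclear_ge.
1,2: by rewrite ltr_pM2r ?invr_gt0 ?ltr0n // ltr_ZtoC.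
move=> /has_pruneP[t' [u [s /hasP[e ec /andP[su /IH[b lt_b lt']]]]]].
exists (b + ZtoC C (cbound e) / 1000%:R).
  by rewrite -ltrBlDr -mulrBl -(raddfB (ZtoC C)); exact: lt_b.
by apply: nuclear_ge_prune s lt' _; exact: certificate_nuclear_ge.
Qed.

Definition surplus t :=
  exists2 b : C, (nverts t)%:R < b & nuclear_ge (@tadj t) b.

Lemma ZtoC_thousandths n : ZtoC C (Z.mul 1000 (Z.of_nat n)) / 1000%:R = n%:R.
Proof.
rewrite Z_ringE rmorphM /= ZtoC_1000 ZtoC_nat.
by rewrite mulrC mulKf // pnatr_eq0.
Qed.

Lemma surplus_certP t : surplus_cert t -> surplus t.
Proof. by move=> /exceedsP[b]; rewrite ZtoC_thousandths => ? ?; exists b. Qed.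

Lemma sim_surplus t u : sim t u -> surplus u -> surplus t.
Proof.
move=> s [b lt_b lb]; exists b; first by rewrite (sim_size s).
exact: nuclear_ge_tiso (tiso_sym (sim_tiso s)) lb.
Qed.

(** The trichotomy E < n, E = n, E > n for [Bin s Emp], with the first two cases given by explicit
    lists. *)
Definition classified s :=
  [\/ has (sim s) exceptional, has (sim s) critical | surplus (Bin s Emp)].

Lemma settled_classified s : settled s -> classified s.
Proof.
case/orP=> [/orP[]|/surplus_certP] h.
- exact: Or31.
- exact: Or32.
- exact: Or33.
Qed.

Lemma sim_classified s s0 : sim s s0 -> classified s0 -> classified s.
Proof.
move=> ss0 [/hasP[e ein se]|/hasP[e ein se]|h].
- by apply: Or31; apply/hasP; exists e => //; exact: sim_trans se.
- by apply: Or32; apply/hasP; exists e => //; exact: sim_trans se.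
- by apply: Or33; apply: sim_surplus h; rewrite /= ss0.
Qed.

(** Replacing both pieces by their representatives turns [s] into one of the finitely many grafts
    already checked. *)
Lemma graft_classified s s' u e u0 : prune s s' u -> sim s' e -> sim u u0 ->
  all_graft settled e u0 -> classified s.
Proof.
move=> sp s'e uu0 ge; have [s0 sp0 ss0] := prune_sim sp s'e uu0.
by apply: sim_classified ss0 _; apply: settled_classified; exact: all_graftP ge.
Qed.

Lemma critical_nuclear_ge s : has (sim s) critical ->
  nuclear_ge (@tadj (Bin s Emp)) ((nverts (Bin s Emp))%:R : C).
Proof.
have h e : e \in certificates ->
    Z.mul 1000 (Z.of_nat (nverts (Bin (cbody e) Emp))) = cbound e ->
    sim s (cbody e) -> nuclear_ge (@tadj (Bin s Emp)) ((nverts (Bin s Emp))%:R : C).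
  move=> ec vale se.
  have ss : sim (Bin s Emp) (Bin (cbody e) Emp) by rewrite /= se.
  apply: nuclear_ge_tiso (tiso_sym (sim_tiso ss)) _.
  rewrite (sim_size ss) -[(nverts _)%:R]ZtoC_thousandths vale.
  exact: (lower_certP C (allP certificates_valid e ec)).
case/hasP=> z; rewrite !inE => /orP[]/eqP->.
  (* Entries 0 and 6 of [certificates] are K_2 and Q, whose bounds are exact. *)
  by apply: (h (nth (Emp, Z0, Z0, [::]) certificates 0)); rewrite ?mem_nth.
by apply: (h (nth (Emp, Z0, Z0, [::]) certificates 6)); rewrite ?mem_nth.
Qed.

Lemma btree_classified s : classified s.
Proof.
have [n] := ubnP (nverts s); elim: n s => // n IH s /ltnSE le_n.
have [/hasP[s0 s0B ss0]|[s' [u [u0 [sp uu0 u0c]]]]] := stuck_or_prune s.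
  apply: sim_classified ss0 _; apply: settled_classified.
  exact: (allP stuck_settled).
(* The piece cut off is nonempty, so the induction hypothesis applies to what remains. *)
have u_gt0 : (0 < nverts u)%N.
  rewrite (sim_size uu0); move: u0c; rewrite mem_filter => /andP[_].
  by case/allpairsP=> p [_ _ ->].
have [|/hasP[e ein s'e]|/hasP[e ein s'e]|[b' lt_b' ge_b']] := IH s'.
- by apply: leq_trans le_n; rewrite (prune_size sp) -addn1 leq_add2l.
- exact: graft_classified sp s'e uu0
    (allP (allP graft_exceptional_settled e ein) u0 u0c).
(* The remainder is tight, so strictness has to come from the piece cut off, unless that piece is
   K_2. *)
- have [u2|u_sur] := orP (allP cuts_surplus u0 u0c).
    exact: graft_classified sp s'e (sim_trans uu0 u2)
      (allP graft_critical_settled e ein).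
  have [b lt_b ge_b] := sim_surplus uu0 (surplus_certP u_sur).
  (* The cut is made in [Bin s Emp], so the root leaf stays with the remainder [Bin s' Emp]. *)
  apply: Or33; exists ((nverts (Bin s' Emp))%:R + b).
    by rewrite (prune_size (prune_l Emp sp)) natrD ltrD2l.
  apply: nuclear_ge_prune (prune_l Emp sp) _ ge_b.
  by apply: critical_nuclear_ge; apply/hasP; exists e.
(* The remainder already gives strictness, so a weak bound suffices for the piece cut off, and K_2
   is allowed. *)
- have [b le_b ge_b] : exists2 b : C, (nverts u)%:R <= b & nuclear_ge (@tadj u) b.
    have [u2|u_sur] := orP (allP cuts_surplus u0 u0c).
      have ss := sim_trans uu0 u2.
      exists (nverts u)%:R => //; rewrite (sim_size ss).
      apply: nuclear_ge_tiso (tiso_sym (sim_tiso ss)) _.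
      exact: (@critical_nuclear_ge leaf).
    have [b /ltW le_b ge_b] := sim_surplus uu0 (surplus_certP u_sur).
    by exists b.
  apply: Or33; exists (b' + b).
    by rewrite (prune_size (prune_l Emp sp)) natrD ltr_leD.
  exact: nuclear_ge_prune (prune_l Emp sp) ge_b' ge_b.
Qed.

Lemma upper_bound_nuclear_le e s : e \in upper_bounds -> sim s e.1.1.1 ->
  nuclear_le (@tadj (Bin s Emp)) (ZtoC C e.2 / 1000%:R).
Proof.
move=> eu se.
have ss : sim (Bin s Emp) (Bin e.1.1.1 Emp) by rewrite /= se.
have [f bf af] := tiso_sym (sim_tiso ss).
exact: nuclear_le_iso bf af (upper_certP C (allP upper_bounds_valid e eu)).
Qed.

(** The first four listed bounds lie one thousandth below the number of vertices. *)
Lemma exceptional_nuclear_le s : has (sim s) exceptional ->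
  exists2 b : C, b < (nverts (Bin s Emp))%:R & nuclear_le (@tadj (Bin s Emp)) b.
Proof.
have h e : e \in upper_bounds ->
    Z.ltb e.2 (Z.mul 1000 (Z.of_nat (nverts (Bin e.1.1.1 Emp)))) ->
    sim s e.1.1.1 ->
    exists2 b : C, b < (nverts (Bin s Emp))%:R & nuclear_le (@tadj (Bin s Emp)) b.
  move=> eu lt_e se; have ss : sim (Bin s Emp) (Bin e.1.1.1 Emp) by rewrite /= se.
  exists (ZtoC C e.2 / 1000%:R); last exact: upper_bound_nuclear_le.
  rewrite (sim_size ss) -[(nverts _)%:R]ZtoC_thousandths ltr_pM2r ?invr_gt0 ?ltr0n //.
  by rewrite ltr_ZtoC.
pose ub k := nth (Emp, Z0, [::], Z0) upper_bounds k.
case/hasP=> z; rewrite !inE => /or4P[]/eqP->.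
- by apply: (h (ub 0)); rewrite ?mem_nth.
- by apply: (h (ub 1)); rewrite ?mem_nth.
- by apply: (h (ub 2)); rewrite ?mem_nth.
- by apply: (h (ub 3)); rewrite ?mem_nth.
Qed.

Lemma critical_nuclear_le s : has (sim s) critical ->
  nuclear_le (@tadj (Bin s Emp)) ((nverts (Bin s Emp))%:R : C).
Proof.
have h e : e \in upper_bounds ->
    Z.mul 1000 (Z.of_nat (nverts (Bin e.1.1.1 Emp))) = e.2 ->
    sim s e.1.1.1 -> nuclear_le (@tadj (Bin s Emp)) ((nverts (Bin s Emp))%:R : C).
  move=> eu vale se.
  have ss : sim (Bin s Emp) (Bin e.1.1.1 Emp) by rewrite /= se.
  rewrite (sim_size ss) -[(nverts _)%:R]ZtoC_thousandths vale; exact: upper_bound_nuclear_le.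
pose ub k := nth (Emp, Z0, [::], Z0) upper_bounds k.
case/hasP=> z; rewrite !inE => /orP[]/eqP->.
- by apply: (h (ub 4)); rewrite ?mem_nth.
- by apply: (h (ub 5)); rewrite ?mem_nth.
Qed.

End TreeEnergy.

(** * Identification of the critical trees, and the equivalence *)

Lemma star2_iso : graph_iso (tgraph (Bin leaf Emp)) (star 2).
Proof.
pose f (x : verts (Bin leaf Emp)) : 'I_2 := if x is None then ord0 else ord_max.
exists f; last by move=> [[[[[]|[]]|]|[]]|] [[[[[]|[]]|]|[]]|].
apply: inj_card_bij; last by rewrite card_ord card_verts.
by move=> [[[[[]|[]]|]|[]]|] [[[[[]|[]]|]|[]]|].
Qed.

Lemma Q_tree_iso : graph_iso (tgraph (Bin (Bin cherry leaf) Emp)) Q_tree.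
Proof.
pose i0 : 'I_2 := ord0; pose i1 : 'I_2 := ord_max.
(* The root leaf and the leaf at distance 2 from it hang at one end of the central edge, the two
   leaves of the cherry at the other. *)
pose f (x : verts (Bin (Bin cherry leaf) Emp)) : Q_tree := match x with
  | None => inr (i0, i0)
  | Some (inl None) => inl i0
  | Some (inl (Some (inr _))) => inr (i0, i1)
  | Some (inl (Some (inl None))) => inl i1
  | Some (inl (Some (inl (Some (inl _))))) => inr (i1, i0)
  | Some (inl (Some (inl (Some (inr _))))) => inr (i1, i1)
  | Some (inr y) => of_void _ y end.
exists f.
  apply: inj_card_bij; last by rewrite card_sum card_prod !card_ord card_verts.
  by move=> [[[[[[[[[]|[]]|]|[[[]|[]]|]]|]|[[[]|[]]|]]|]|[]]|]
    [[[[[[[[[]|[]]|]|[[[]|[]]|]]|]|[[[]|[]]|]]|]|[]]|].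
by move=> [[[[[[[[[]|[]]|]|[[[]|[]]|]]|]|[[[]|[]]|]]|]|[]]|]
  [[[[[[[[[]|[]]|]|[[[]|[]]|]]|]|[[[]|[]]|]]|]|[]]|].
Qed.

Lemma graph_iso_sym G H : graph_iso G H -> graph_iso H G.
Proof.
move=> [f [g fK gK] af]; exists g; first by exists f.
by move=> x y; rewrite -af !gK.
Qed.

Lemma graph_iso_trans G H K : graph_iso G H -> graph_iso H K -> graph_iso G K.
Proof.
move=> [f bf af] [g bg ag]; exists (g \o f); first exact: bij_comp.
by move=> x y /=; rewrite ag af.
Qed.

Lemma critical_energy (C : numClosedFieldType) (G : sgraph) s :
  has (sim s) critical -> graph_iso (tgraph (Bin s Emp)) G ->
  energy C G = #|G|%:R.
Proof.
move=> crit [f bf af].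
have -> : #|G| = nverts (Bin s Emp) by rewrite -(bij_eq_card bf) card_verts.
apply/eqP; rewrite eq_le; apply/andP; split.
  apply: nuclear_le_energy; apply: nuclear_le_iso bf af _.
  exact: critical_nuclear_le.
apply: nuclear_ge_energy (realn _ _); apply: nuclear_ge_iso bf af _.
exact: critical_nuclear_ge.
Qed.

Theorem theorem2p5 (R : realType) (T : sgraph) (n : nat)
    (hT : is_tree T) (hn : #|T| = n) (hdeg : (max_degree T <= 3)%N) :
  energy R[i] T = n%:R <-> graph_iso T (star 2) \/ graph_iso T Q_tree.
Proof.
split; last first.
  rewrite -hn => -[iso|iso].
    apply: (@critical_energy _ _ leaf) => //.
    exact: graph_iso_trans star2_iso (graph_iso_sym iso).
  apply: (@critical_energy _ _ (Bin cherry leaf)) => //.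
  exact: graph_iso_trans Q_tree_iso (graph_iso_sym iso).
have [s [f [bf af]]] := tree_leaf_rooted hT hdeg.
have <- : nverts (Bin s Emp) = n by rewrite -hn -(bij_eq_card bf) card_verts.
(* Energy equal to [n] excludes the first and third alternatives; the second leaves K_2 and Q. *)
move=> eqE; case: (btree_classified R[i] s) => [exc|crit|[b lt_b ge_b]].
- have [b lt_b le_b] := exceptional_nuclear_le R[i] exc.
  have := nuclear_le_energy (nuclear_le_iso bf af le_b).
  by rewrite eqE lt_geF.
- have iso : graph_iso T (tgraph (Bin s Emp)) by apply: graph_iso_sym; exists f.
  have [z zc sz] := hasP crit.
  have {}iso : graph_iso T (tgraph (Bin z Emp)).
    apply: graph_iso_trans iso _.
    have : sim (Bin s Emp) (Bin z Emp) by rewrite /= sz.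
    by case/sim_tiso=> g bg ag; exists g.
  move: zc iso; rewrite !inE => /orP[]/eqP-> iso.
    by left; apply: graph_iso_trans iso star2_iso.
  by right; apply: graph_iso_trans iso Q_tree_iso.
have := nuclear_ge_energy (nuclear_ge_iso bf af ge_b).
(* [b] is real because it is comparable with a natural number. *)
have -> : b \is Num.real by rewrite (ger_real (ltW lt_b)) realn.
by move=> /(_ isT); rewrite eqE lt_geF.
Qed.
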